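(* For every $n\in\mathbb{N}$, the prefractal Koch snowflake flat surface $\mathcal{S}(KS_n)$ is a branched cover of the flat surface $\mathcal{S}(KS_0)$.
   Context: Let $KS_0=\Delta$ be the equilateral triangle of side length $1$. For $n\ge 0$, $KS_{n+1}$ is obtained from the polygon $KS_n$ by removing the open middle third of each of its $3\cdot 4^n$ sides and replacing it by the two other sides of the equilateral triangle erected on it, pointing outward. $KS_n$ is the $n$th (inner) polygonal approximation of the Koch snowflake $KS$, and $\Omega(KS_n)$ is the compact region of the plane bounded by $KS_n$. The flat surface $\mathcal{S}(KS_n)$ is $(\Omega(KS_n)\times D_3)/\sim$, where $D_3$ (of order $6$) is the dihedral group generated by the linear parts of the reflections in the sides of $\Omega(KS_n)$, and $(p_1,r_1)\sim(p_2,r_2)$ if and only if $p_1=p_2$ and one of the following holds: (1) $r_1=r_2$; (2) $p_1=p_2$ lies on a side $s_a$ and $r_1^{-1}r_2=r_a$, the linear part of the reflection in $s_a$; (3) $p_1=p_2$ is a vertex with adjacent sides $s_a,s_b$ and $r_1^{-1}r_2$ belongs to the subgroup generated by $r_a$ and $r_b$. It is a compact connected orientable surface with a flat structure (translation transition maps away from the finitely many points coming from vertices). $\mathcal{S}(KS_0)$ is the hexagonal torus. A continuous map $p:E\to B$ of topological spaces is a branched cover of $B$ (and one says $E$ is a branched cover of $B$) if for all but a finite number of points of $B$, $p$ is a covering map of $E$ onto $B$, i.e. all but finitely many points of $B$ are evenly covered by $p$; the set of points of $B$ that are not evenly covered is the branch locus. *)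

(* Defs.v *)
From HB Require Import structures.
From Stdlib Require Import Relations.
From mathcomp Require Import all_boot all_order all_algebra.
From mathcomp Require Import generic_quotient.
From mathcomp Require Import all_classical all_reals all_analysis.
Set Implicit Arguments.
Unset Strict Implicit.
Unset Printing Implicit Defensive.
Import Order.TTheory GRing.Theory Num.Theory.
Import numFieldNormedType.Exports.
Local Open Scope classical_set_scope.
Local Open Scope ring_scope.
Local Open Scope quotient_scope.

(** A polygon is the cyclic list of its vertices; its sides are oriented, from
    each vertex to the next one. *)
Section Polygon.
Variable R : realType.
Local Notation plane := 'cV[R]_2.
Implicit Types (P : seq plane) (a b d p : plane) (S : set 'M[R]_2).

Definition pt (x y : R) : plane := \col_(i < 2) [:: x; y]`_i.

Definition sides P : seq (plane * plane) := zip P (rot 1 P).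

Definition segment a b : set plane :=
  [set a + t *: (b - a) | t in `[0, 1]%classic].

Definition curve P : set plane :=
  [set p | exists2 s, s \in sides P & segment s.1 s.2 p].

(** The region bounded by a Jordan curve: the curve together with the bounded
    component of its complement. *)
Definition region P : set plane :=
  curve P `|` [set p | ~ curve P p /\
                       bounded_set (connected_component (~` curve P) p)].

(** The linear part of the reflection in a line of direction [d <> 0], namely
    [x |-> 2 (<x, d> / <d, d>) d - x]. *)
Definition linrefl d : 'M[R]_2 :=
  (2 / (d^T *m d) 0 0) *: (d *m d^T) - 1%:M.

Definition side_refl (s : plane * plane) : 'M[R]_2 := linrefl (s.2 - s.1).

Definition generated_group S : set 'M[R]_2 :=
  smallest [set G | G 1 /\ forall r s, G r -> G s -> G (r / s)] S.

Definition dihedral P : set 'M[R]_2 :=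
  generated_group [set r | exists2 s, s \in sides P & r = side_refl s].

Definition copies P : topologicalType :=
  (region P * discrete_topology (dihedral P))%type.

Definition copy_pt P (x : copies P) : plane := set_val x.1.
Definition copy_mx P (x : copies P) : 'M[R]_2 := set_val (x.2 : dihedral P).

(** In the third case, [sa] and [sb] are the sides ending and starting at the
    vertex. *)
Definition glued P (x y : copies P) : Prop :=
  let r := (copy_mx x)^-1 * copy_mx y in
  copy_pt x = copy_pt y /\
  [\/ copy_mx x = copy_mx y,
      exists2 sa, sa \in sides P &
        segment sa.1 sa.2 (copy_pt x) /\ r = side_refl sa
    | exists sa sb, [/\ sa \in sides P, sb \in sides P, sa.2 = copy_pt x,
        sb.1 = copy_pt x &
        generated_group [set side_refl sa; side_refl sb] r]].

(** For a simple closed polygon, [glued] is an equivalence relation, hence equal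
    to the one it generates. The latter is an equivalence for any list [P]. *)
Definition glue P : rel (copies P) :=
  fun x y => `[< clos_refl_sym_trans _ (@glued P) x y >].

Lemma glue_equiv P : equiv_class_of (@glue P).
Proof.
split=> [x|x y|y x z]; first exact/asboolP/rst_refl.
- by apply/asboolP/asboolP; exact: rst_sym.
- move=> /asboolP xy /asboolP yz; apply/asboolP.
  exact: rst_trans xy yz.
Qed.

Canonical glue_equiv_rel P := EquivRelPack (glue_equiv P).

Definition flat_surface P : topologicalType :=
  quotient_topology {eq_quot (glue_equiv_rel P)}.

(** The rotation of angle [- pi / 3]. *)
Definition turn d : plane :=
  pt (d 0 0 / 2 + Num.sqrt 3 / 2 * d 1 0)
     (d 1 0 / 2 - Num.sqrt 3 / 2 * d 0 0).

(** The vertices that replace the side from [a] to [b], the endpoint [b]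
    excluded. Polygons are listed counterclockwise, so outward is to the right
    of [b - a], and the subdivided polygon is again counterclockwise. *)
Definition koch_side (s : plane * plane) : seq plane :=
  let a := s.1 in let d := 3^-1 *: (s.2 - s.1) in
  [:: a; a + d; a + d + turn d; a + 2 *: d].

Fixpoint KS (n : nat) : seq plane :=
  if n is m.+1 then flatten [seq koch_side s | s <- sides (KS m)]
  else [:: pt 0 0; pt 1 0; pt (1 / 2) (Num.sqrt 3 / 2)].

End Polygon.
Arguments KS : clear implicits.

Section BranchedCover.
Variables E B : topologicalType.
Implicit Types (p : E -> B) (V : set E) (U : set B).

Definition maps_homeomorphically p V U : Prop :=
  exists g : B -> E,
    [/\ set_fun V U p, set_fun U V g,
        {in V, cancel p g}, {in U, cancel g p} &
        {within V, continuous p} /\ {within U, continuous g}].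

Definition evenly_covered p (b : B) : Prop :=
  exists (U : set B) (W : set (set E)),
    [/\ open_nbhs b U, p @^-1` U = \bigcup_(V in W) V, trivIset W id,
        W `<=` open & forall V, W V -> maps_homeomorphically p V U].

Definition branched_covering p : Prop :=
  [/\ continuous p, range p = setT &
      finite_set [set b | ~ evenly_covered p b]].

End BranchedCover.

Definition is_branched_cover_of (E B : topologicalType) : Prop :=
  exists p : E -> B, branched_covering p.

(* Main.v *)
Require Import Defs.
From Stdlib Require Import Relations.
From mathcomp Require Import all_boot all_order all_algebra.
From mathcomp Require Import all_classical all_reals all_analysis.
From mathcomp Require Import zify ring lra.
Set Implicit Arguments.
Unset Strict Implicit.
Unset Printing Implicit Defensive.
Import Order.TTheory GRing.Theory Num.Theory.
Import numFieldNormedType.Exports.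
Local Open Scope classical_set_scope.
Local Open Scope ring_scope.

(** Three families of parallel lines cut the plane into equilateral triangles
    of side 3^-n, and the region bounded by [KS R n] is a union of finitely many
    of these small triangles.
    Reflecting in these lines folds the plane onto one small triangle, so that
    every small triangle gets a chart defined on the unit triangle, and the
    charts of two adjacent small triangles agree on their common edge. The
    surface is therefore made of tiles [(a, r)], where [a] is a small triangle
    of the region and [r] an element of the dihedral group, and each edge of a
    tile is glued to the edge of the same name of exactly one other tile: of
    [(b, r)] if the small triangle [b] behind the edge belongs to the region,
    and of [(a, r * s)], where [s] is the reflection in that edge, if it does
    not. Let the colour of [(a, r)] be [r] times the linear part of the folding
    isometry from the unit triangle to [a]. In both cases, crossing the edge
    named [e] multiplies the colour on the right by the reflection in the edge
    [e] of the unit triangle. The surface of [KS R 0] obeys the same rule and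
    has exactly one tile of each colour, so matching colours defines a map to
    it, and this map takes the two tiles around an edge to the two tiles around
    an edge. Hence every point that is not a vertex of a tile is evenly
    covered; this is [tiled_branched_cover], which knows nothing of polygons.

    What depends on the snowflake is that exactly one of the two triangles at
    each side of [KS R n] lies in the region, which is defined by bounded
    components. The tiles of the snowflake are given by a recursion, [inside]:
    a small triangle of level [n + 1] is inside if the triangle of level [n]
    that contains it is, or if it is the bump put on a side of that triangle.
    By [boundaryS] the edges between inside and outside tiles follow the Koch
    substitution, hence are the sides of the polygon ([sides_KS]). Inside tiles
    are bounded, and their union is closed and, off the curve, open. No outside
    tile has two inside neighbours ([outside_nbr_unique]), which is what lets
    every outside tile be joined to infinity through outside tiles ([escape]).
    So the region is the union of the inside tiles ([region_KS]).

    A point is described by its heights over the three directions of the sides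
    of the unit triangle, scaled so that they sum to zero and that the lines of
    the tiling are the points with an integer height. A tile is the triple of
    the floors of the heights of its interior points; the sum of the triple is -1 for
    the translates of the unit triangle and -2 for the inverted triangles. *)

(** * Triangular tiling *)

(** The directions of the sides of the unit triangle, in counterclockwise
    order. They also name its edges, and serve as the integers modulo 3. *)
Inductive dir := D0 | D1 | D2.

Definition next k := match k with D0 => D1 | D1 => D2 | D2 => D0 end.

Definition same k l :=
  match k, l with D0, D0 | D1, D1 | D2, D2 => true | _, _ => false end.

Lemma same_eq k l : same k l -> k = l.
Proof. by case: k; case: l. Qed.

Lemma dir_eq_dec (k l : dir) : {k = l} + {k <> l}.
Proof. by decide equality. Qed.

Lemma dir_neq k l : k <> l -> l = next k \/ l = next (next k).
Proof. by case: k; case: l => //; auto. Qed.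

Definition tile := dir -> int.

Section Tiling.
Implicit Types (a b c : tile) (k l : dir).

Definition tile_sum a : int := a D0 + a D1 + a D2.

Definition is_tile a := (tile_sum a == -1) || (tile_sum a == -2).

(** The tile behind the edge of direction [k]: the [k]-th floor goes down for
    an upward tile and up for an inverted one. The integer
    [2 * tile_sum a + 3] is 1 or -1 accordingly, which keeps the formula linear. *)
Definition nbr k a : tile :=
  fun i => if same k i then a i - (2 * tile_sum a + 3) else a i.

Definition parent a : tile := fun i => (a i %/ 3)%Z.

(** Among the nine subtiles of a tile, the one that touches the middle third
    of the edge of direction [k]. *)
Definition bump k a :=
  [&& (a (next k) %% 3)%Z == 1, (a (next (next k)) %% 3)%Z == 1
    & (a k %% 3)%Z != 1].

(** The tile that is the unit triangle. *)
Definition seed : tile := fun i => if same D1 i then -1 else 0.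

(** The tile behind the outer edge of a bump has as its parent the tile behind
    the edge that carries the bump. *)
Fixpoint inside n a :=
  if n is m.+1 then
    [|| inside m (parent a), bump D0 a && inside m (parent (nbr D0 a)),
        bump D1 a && inside m (parent (nbr D1 a))
      | bump D2 a && inside m (parent (nbr D2 a))]
  else [&& a D0 == 0, a D1 == -1 & a D2 == 0].

Lemma tile_ext a b : a D0 = b D0 -> a D1 = b D1 -> a D2 = b D2 -> a = b.
Proof. by move=> e0 e1 e2; apply/funext; case. Qed.

Lemma insideS n a : inside n.+1 a <->
  inside n (parent a) \/ exists k, bump k a /\ inside n (parent (nbr k a)).
Proof.
split.
  by case/or4P => [?|/andP[? ?]|/andP[? ?]|/andP[? ?]];
    [left|right; exists D0|right; exists D1|right; exists D2].
move=> [ia|[[] [bk ik]]] /=; first (by rewrite ia); by rewrite bk ik ?orbT.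
Qed.

Lemma inside0 a : inside 0 a -> a = seed.
Proof. by move=> /= /and3P[/eqP ? /eqP ? /eqP ?]; apply: tile_ext. Qed.

Ltac tiling := rewrite /is_tile /bump /nbr /tile_sum /parent /=; lia.

Lemma nbrK k a : is_tile a -> nbr k (nbr k a) = a.
Proof. by case: k => ta; apply: tile_ext; move: ta; tiling. Qed.

Lemma tile_nbr k a : is_tile a -> is_tile (nbr k a).
Proof. by case: k; tiling. Qed.

Lemma tile_parent a : is_tile a -> is_tile (parent a).
Proof. tiling. Qed.

(** The edge of direction [k] of [a] lies on an edge of the parent of [a]. *)
Definition wall k a := (a k %% 3)%Z == - 2 * tile_sum a - 2.

Lemma parent_nbr k a : is_tile a ->
  parent (nbr k a) = if wall k a then nbr k (parent a) else parent a.
Proof.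
move=> ta; case: ifP; rewrite /wall => w; apply: tile_ext; case: k w; move: ta;
 tiling.
Qed.

Lemma bump_wall k a : is_tile a -> bump k a -> wall k a.
Proof. by rewrite /wall; case: k; tiling. Qed.

(** Bumps on two edges of an outside tile would enclose its corner between
    them, which then could not reach infinity. An inside neighbour
    of a subtile always comes from an inside neighbour of the parent, which is
    unique by induction, and this determines the edge of the subtile. *)
Lemma outside_nbr_unique n a k l : is_tile a -> ~~ inside n a ->
  inside n (nbr k a) -> inside n (nbr l a) -> k = l.
Proof.
elim: n a k l => [|n IH] a k l ta.
  move=> _ /inside0 ek /inside0 el.
  have := congr1 (nbr k) ek; have := congr1 (nbr l) el; rewrite !nbrK// => ->.
  move=> /(congr1 (fun b => b k)).
  by case: k {ek}; case: l {el}.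
move=> /negP na /insideS ik /insideS il.
have oa : ~~ inside n (parent a).
  by apply/negP => oa; apply: na; apply/insideS; left.
have step m : inside n (parent (nbr m a)) \/
      (exists j, bump j (nbr m a) /\ inside n (parent (nbr j (nbr m a)))) ->
    (inside n (nbr m (parent a)) /\ wall m a) \/
    exists j, [/\ m <> j, inside n (nbr j (parent a)) & bump j (nbr m a)].
  move=> [im|[j [bj ij]]].
    left; move: im; rewrite parent_nbr//; case: ifP => // _.
    by move: oa; case: inside.
  right; exists j.
  have mj : m <> j.
    by move=> mj; move: ij; rewrite mj nbrK// => ij; move: oa; rewrite ij.
  split => //; move: ij.
  rewrite parent_nbr ?tile_nbr// bump_wall ?tile_nbr//.
  suff -> : parent (nbr m a) = parent a by [].
  rewrite parent_nbr//; case: ifP => // w.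
  by exfalso; move: w bj mj; case: m; case: j => //; rewrite /wall;
    move: ta; tiling.
case: (step _ ik) => [[ik' wk]|[j [kj ij bj]]];
  case: (step _ il) => [[il' wl]|[j' [lj' ij' bj']]].
- exact: IH (tile_parent ta) oa ik' il'.
- have e := IH _ _ _ (tile_parent ta) oa ik' ij'; subst j'.
  exfalso; move: wk bj' lj'; rewrite /wall.
  by case: k {ik ik' ij'}; case: l {il} => //; move: ta; tiling.
- have e := IH _ _ _ (tile_parent ta) oa il' ij; subst j.
  exfalso; move: wl bj kj; rewrite /wall.
  by case: k {ik}; case: l {il il' ij} => //; move: ta; tiling.
have e := IH _ _ _ (tile_parent ta) oa ij ij'; subst j'.
move: bj kj bj' lj'.
by case: k {ik}; case: l {il} => //; case: j {ij ij'} => //; move: ta; tiling.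
Qed.

(** * Escaping to infinity through outside tiles *)

Lemma insideSE n a : is_tile a -> inside n.+1 a <->
  inside n (parent a) \/ exists k, bump k a /\ inside n (nbr k (parent a)).
Proof.
move=> ta; split=> [/insideS|] [?|[k [bk ik]]].
- by left.
- by right; exists k; move: ik; rewrite parent_nbr// bump_wall.
- by apply/insideS; left.
- by apply/insideS; right; exists k; rewrite parent_nbr// bump_wall.
Qed.

(** -1 for upward tiles and 1 for inverted ones. *)
Definition tile_sign b : int := - (2 * tile_sum b + 3).

(** The subtile of [b] at the vertex opposite to the edge of direction [i]. *)
Definition corner i b : tile :=
  fun j => 3 * b j + 1 + tile_sign b - (if same i j then 2 * tile_sign b else 0).

(** The subtile of [b] that separates [corner i b] from the centre of [b]. *)
Definition center i b : tile :=
  fun j => 3 * b j + 1 + tile_sign b - (if same i j then tile_sign b else 0).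

(** The subtile of [b] along the middle third of the edge of direction [i]. *)
Definition middle i b : tile :=
  fun j => 3 * b j + 1 + (if same i j then tile_sign b else 0).

Ltac subtiling := rewrite /corner /center /middle /tile_sign; tiling.

Lemma subtileP a : is_tile a -> exists i,
  [\/ a = corner i (parent a), a = center i (parent a)
    | a = middle i (parent a)].
Proof.
move=> ta.
suff : exists i, [\/ forall j, a j = corner i (parent a) j,
    forall j, a j = center i (parent a) j
    | forall j, a j = middle i (parent a) j].
  by move=> [i [e|e|e]]; exists i;
    [apply: Or31|apply: Or32|apply: Or33]; exact/funext.
have [m0 [m1 m2]] : [/\ (a D0 %% 3)%Z \in [:: 0; 1; 2],
  (a D1 %% 3)%Z \in [:: 0; 1; 2] & (a D2 %% 3)%Z \in [:: 0; 1; 2]].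
  by rewrite !inE; split; lia.
rewrite !inE in m0 m1 m2.
pose s := tile_sign (parent a).
pose residues i (u v : int) := (a i %% 3)%Z = u /\
  (a (next i) %% 3)%Z = v /\ (a (next (next i)) %% 3)%Z = v.
have S : exists i, [\/ residues i (1 - s) (1 + s), residues i 1 (1 + s)
    | residues i (1 + s) 1].
  move: ta; rewrite /residues /s /tile_sign /is_tile /tile_sum /parent.
  clear s residues.
  case/or3P: m0 => /eqP m0; case/or3P: m1 => /eqP m1; case/or3P: m2 => /eqP m2 w;
  try (exfalso; lia);
  let kind := first [apply: Or31; lia|apply: Or32; lia|apply: Or33; lia] in
  first [exists D0; rewrite /= m0 m1 m2; kind
        |exists D1; rewrite /= m0 m1 m2; kind
        |exists D2; rewrite /= m0 m1 m2; kind].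
case: S => i [] [e1 [e2 e3]]; exists i;
 [apply: Or31|apply: Or32|apply: Or33] => j;
 rewrite /corner /center /middle -/s /parent; case: i e1 e2 e3; case: j => /=; lia.
Qed.

Lemma tile_corner i b : is_tile b -> is_tile (corner i b).
Proof. by case: i; subtiling. Qed.

Lemma tile_center i b : is_tile b -> is_tile (center i b).
Proof. by case: i; subtiling. Qed.

Lemma tile_middle i b : is_tile b -> is_tile (middle i b).
Proof. by case: i; subtiling. Qed.

Lemma parent_corner i b : is_tile b -> parent (corner i b) = b.
Proof. by move=> tb; apply: tile_ext; case: i; move: tb; subtiling. Qed.

Lemma parent_center i b : is_tile b -> parent (center i b) = b.
Proof. by move=> tb; apply: tile_ext; case: i; move: tb; subtiling. Qed.

Lemma parent_middle i b : is_tile b -> parent (middle i b) = b.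
Proof. by move=> tb; apply: tile_ext; case: i; move: tb; subtiling. Qed.

Lemma bump_corner i j b : is_tile b -> ~~ bump j (corner i b).
Proof. by case: i; case: j; subtiling. Qed.

Lemma bump_center i j b : is_tile b -> ~~ bump j (center i b).
Proof. by case: i; case: j; subtiling. Qed.

Lemma bump_middle i j b : is_tile b -> bump j (middle i b) = same i j.
Proof. by case: i; case: j => tb; apply/idP; move: tb; subtiling. Qed.

Lemma inside_corner n i b : is_tile b ->
  inside n.+1 (corner i b) = inside n b.
Proof.
move=> tb; apply/idP/idP.
  move/(insideSE _ (tile_corner _ tb)); rewrite parent_corner// => -[//|[j [+ _]]].
  by rewrite (negbTE (bump_corner _ _ tb)).
by move=> ib; apply/(insideSE _ (tile_corner _ tb)); left; rewrite parent_corner.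
Qed.

Lemma inside_center n i b : is_tile b ->
  inside n.+1 (center i b) = inside n b.
Proof.
move=> tb; apply/idP/idP.
  move/(insideSE _ (tile_center _ tb)); rewrite parent_center// => -[//|[j [+ _]]].
  by rewrite (negbTE (bump_center _ _ tb)).
by move=> ib; apply/(insideSE _ (tile_center _ tb)); left; rewrite parent_center.
Qed.

Lemma inside_middle n i b : is_tile b ->
  inside n.+1 (middle i b) = inside n b || inside n (nbr i b).
Proof.
move=> tb; apply/idP/orP.
  move/(insideSE _ (tile_middle _ tb)); rewrite parent_middle// => -[|[j []]].
    by left.
  by rewrite bump_middle// => /same_eq <-; right.
move=> ib; apply/(insideSE _ (tile_middle _ tb)); rewrite parent_middle//.
case: ib => ib; [by left|right; exists i; rewrite bump_middle//].
by split=> //; case: i {ib}.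
Qed.

Lemma nbr_corner i b : is_tile b -> nbr i (corner i b) = center i b.
Proof. by move=> tb; apply: tile_ext; case: i; move: tb; subtiling. Qed.

Lemma nbr_middle k b : is_tile b -> nbr k (middle k b) = middle k (nbr k b).
Proof. by move=> tb; apply: tile_ext; case: k; move: tb; subtiling. Qed.

Lemma nbr_middle1 k b : is_tile b ->
  nbr (next k) (middle k b) = center (next (next k)) b.
Proof. by move=> tb; apply: tile_ext; case: k; move: tb; subtiling. Qed.

Lemma nbr_middle2 k b : is_tile b ->
  nbr (next (next k)) (middle k b) = center (next k) b.
Proof. by move=> tb; apply: tile_ext; case: k; move: tb; subtiling. Qed.

(** Adjacent outside tiles: no side of the snowflake separates them. *)
Definition link n a b :=
  [/\ is_tile a, ~~ inside n a, ~~ inside n b & exists k, b = nbr k a].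

Definition reach n := clos_refl_trans tile (link n).

Lemma link_sym n a b : link n a b -> link n b a.
Proof.
by move=> [ta oa ob [k e]]; split=> //; [rewrite e tile_nbr|exists k; rewrite e nbrK].
Qed.

Lemma reach_sym n a b : reach n a b -> reach n b a.
Proof.
elim=> [x y l|x|x y z _ yx _ zy]; first exact/rt_step/link_sym.
- exact: rt_refl.
- exact: rt_trans zy yx.
Qed.

Lemma reach_nbr n k a b : is_tile a -> ~~ inside n a -> ~~ inside n b ->
  nbr k a = b -> reach n a b.
Proof. by move=> ta oa ob e; apply: rt_step; split=> //; exists k. Qed.

(** The centres of an outside tile form a cycle with its middles, and at most
    one of the middles is a bump: removing it leaves the cycle connected. *)
Lemma reach_centers n b i j : is_tile b -> ~~ inside n b ->
  reach n.+1 (center i b) (center j b).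
Proof.
move=> tb ob.
have oc k : ~~ inside n.+1 (center k b) by rewrite inside_center.
have mid k : ~~ inside n (nbr k b) ->
    reach n.+1 (center (next k) b) (center (next (next k)) b).
  move=> ok.
  have om : ~~ inside n.+1 (middle k b) by rewrite inside_middle// negb_or ob.
  apply: (rt_trans _ _ _ (middle k b)); last first.
    exact: reach_nbr (tile_middle _ tb) om (oc _) (nbr_middle1 _ tb).
  apply: reach_sym.
  exact: reach_nbr (tile_middle _ tb) om (oc _) (nbr_middle2 _ tb).
have uniq := outside_nbr_unique tb ob.
have all k : reach n.+1 (center (next k) b) (center (next (next k)) b).
  have [ik|] := boolP (inside n (nbr k b)); last exact: mid.
  have o1 : ~~ inside n (nbr (next k) b).
    by apply/negP => /(uniq _ _ ik); case: k {ik}.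
  have o2 : ~~ inside n (nbr (next (next k)) b).
    by apply/negP => /(uniq _ _ ik); case: k {ik o1}.
  have := mid _ o1; have := mid _ o2.
  have -> : next (next (next k)) = k by case: k {ik o1 o2}.
  by move=> /reach_sym + /reach_sym; exact: rt_trans.
case: (dir_eq_dec i j) => [->|]; first exact: rt_refl.
move=> /dir_neq[] ->; last by apply: reach_sym; have := all (next i); case: i.
by have := all (next (next i)); case: i.
Qed.

Lemma reach_siblings n a b : is_tile a -> is_tile b -> ~~ inside n.+1 a ->
  ~~ inside n.+1 b -> parent a = parent b -> reach n.+1 a b.
Proof.
move=> ta tb oa ob ab.
have to_center c : is_tile c -> ~~ inside n.+1 c -> ~~ inside n (parent c) /\
    exists i, reach n.+1 c (center i (parent c)).
  move=> tc oc; have op : ~~ inside n (parent c).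
    by apply: contra oc => ip; apply/(insideSE _ tc); left.
  split=> //.
  have [i] := subtileP tc; have tp := tile_parent tc.
  have ox k : ~~ inside n.+1 (center k (parent c)) by rewrite inside_center.
  case=> e.
  - by exists i; apply: (@reach_nbr _ i _ _ tc oc (ox i)); rewrite -nbr_corner// -e.
  - by exists i; rewrite -e; exact: rt_refl.
  - exists (next (next i)); apply: (@reach_nbr _ (next i) _ _ tc oc (ox _)).
    by rewrite -nbr_middle1// -e.
have [opa [i ra]] := to_center _ ta oa.
have [_ [j rb]] := to_center _ tb ob.
apply: (rt_trans _ _ _ _ _ ra); apply: rt_trans (reach_sym rb).
by rewrite -ab; apply: reach_centers => //; exact: tile_parent.
Qed.

(** A chain of outside tiles lifts to the next level: two adjacent outside
    tiles carry no bump on their common edge, so their middles along it are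
    adjacent outside tiles. *)
Lemma reach_sub n a b : reach n (parent a) (parent b) ->
  is_tile a -> is_tile b -> ~~ inside n.+1 a -> ~~ inside n.+1 b ->
  reach n.+1 a b.
Proof.
move=> r ta tb oa ob; have {r} := clos_rt_rt1n _ _ _ _ r.
move ax : (parent a) => x; move bz : (parent b) => y r.
elim: r a ta oa ax bz => {x y} [x|x y z [tx ox oy [k yE]] _ IH] a ta oa ax bz.
  by apply: reach_siblings => //; rewrite ax.
have ty : is_tile y by rewrite yE; exact: tile_nbr.
have o1 : ~~ inside n.+1 (middle k x).
  by rewrite inside_middle// negb_or ox -yE.
have o2 : ~~ inside n.+1 (middle k y).
  by rewrite inside_middle// negb_or oy yE nbrK.
apply: (rt_trans _ _ _ (middle k x)).
  by apply: reach_siblings => //; [exact: tile_middle|rewrite parent_middle].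
apply: (rt_trans _ _ _ (middle k y)).
  apply: (reach_nbr (tile_middle _ tx) o1 o2).
  by rewrite yE; exact: nbr_middle.
by apply: IH => //; [exact: tile_middle|rewrite parent_middle].
Qed.

Lemma outside_reach n a b : ~~ inside n a -> is_tile a -> reach n a b ->
  ~~ inside n b /\ is_tile b.
Proof.
move=> oa ta r; elim: r oa ta => // {a b} [x y [_ _ oy [k e]]|x y z _ xy _ yz] ox tx.
  by split=> //; rewrite e tile_nbr.
by have [oy ty] := xy ox tx; apply: yz.
Qed.

(** Along a row of tiles, one of the two directions avoids the seed. *)
Lemma escape0 a (N : nat) : is_tile a -> ~~ inside 0 a ->
  exists2 b, reach 0 a b & N%:Z < `|b D2|.
Proof.
have right m c : tile_sum c = -1 -> (c D0 != 0) || (1 <= c D2) ->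
    exists2 b, reach 0 c b & b D2 = c D2 + m%:Z.
  elim: m c => [|m IH] c hc cond; first by exists c; [exact: rt_refl|rewrite addr0].
  pose d := nbr D2 (nbr D1 c).
  have tc : is_tile c by rewrite /is_tile hc.
  have [||b rb eb] := IH d.
  - by move: hc; rewrite /d; tiling.
  - by move: hc cond; rewrite /d; tiling.
  exists b; last by rewrite eb /d; move: hc; tiling.
  apply: rt_trans rb; apply: (rt_trans _ _ _ (nbr D1 c)).
    by apply: (@reach_nbr 0 D1) => //; move: hc cond; rewrite /inside ?/d; tiling.
  apply: (@reach_nbr 0 D2) => //; first exact: tile_nbr.
    by move: hc cond; rewrite /inside ?/d; tiling.
  by move: hc cond; rewrite /inside ?/d; tiling.
have left m c : tile_sum c = -1 -> c D0 = 0 -> c D2 <= -1 ->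
    exists2 b, reach 0 c b & b D2 = c D2 - m%:Z.
  elim: m c => [|m IH] c hc c0 cond; first by exists c; [exact: rt_refl|rewrite subr0].
  pose d := nbr D1 (nbr D2 c).
  have tc : is_tile c by rewrite /is_tile hc.
  have [|||b rb eb] := IH d.
  - by move: hc; rewrite /d; tiling.
  - by move: hc c0; rewrite /d; tiling.
  - by move: hc cond; rewrite /d; tiling.
  exists b; last by rewrite eb /d; move: hc; tiling.
  apply: rt_trans rb; apply: (rt_trans _ _ _ (nbr D2 c)).
    by apply: (@reach_nbr 0 D2) => //; move: hc cond; rewrite /inside ?/d; tiling.
  apply: (@reach_nbr 0 D1) => //; first exact: tile_nbr.
    by move: hc cond; rewrite /inside ?/d; tiling.
  by move: hc cond; rewrite /inside ?/d; tiling.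
move=> ta oa.
pose M := (`|a D2| + N).+2.
have [hr|hr] := boolP ((a D0 != 0) || (1 <= a D2) || (tile_sum a == -2) && (0 <= a D2)).
  have [ha|ha] : tile_sum a = -1 \/ tile_sum a = -2 by move: ta; tiling.
    have [||b rb eb] := right M a => //.
      by move: hr ha; tiling.
    by exists b => //; rewrite eb /M; lia.
  have [||b rb eb] := right M (nbr D2 a).
  - by move: ha; tiling.
  - by move: hr ha; tiling.
  exists b; last by rewrite eb /M; move: ha; tiling.
  apply: rt_trans rb; apply: (@reach_nbr 0 D2) => //.
  by move: hr ha; rewrite /inside ?/d; tiling.
have [ha|ha] : tile_sum a = -1 \/ tile_sum a = -2 by move: ta; tiling.
  have [|||b rb eb] := left M a => //.
  - by move: hr ha; tiling.
  - by move: hr ha oa; rewrite /inside ?/d; tiling.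
  by exists b => //; rewrite eb /M; move: hr ha oa; rewrite /inside ?/d; tiling.
have [|||b rb eb] := left M (nbr D1 a).
- by move: ha; tiling.
- by move: hr ha; tiling.
- by move: hr ha; tiling.
exists b; last by rewrite eb /M; move: ha hr; tiling.
apply: rt_trans rb; apply: (@reach_nbr 0 D1) => //.
by move: hr ha; rewrite /inside ?/d; tiling.
Qed.

Lemma escape n a (N : nat) : is_tile a -> ~~ inside n a ->
  exists2 b, reach n a b & N%:Z < `|b D2|.
Proof.
elim: n a N => [|n IH] a N ta oa; first exact: escape0.
have tp := tile_parent ta.
have op : ~~ inside n (parent a).
  by apply: contra oa => ip; apply/(insideSE _ ta); left.
(* The floors of a subtile are three times those of its parent, up to 2. *)
have [b rb Nb] := IH _ N.+2 tp op.
have [ob tb] := outside_reach op tp rb.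
have oc : ~~ inside n.+1 (center D0 b) by rewrite inside_center.
exists (center D0 b); last by move: Nb tb; subtiling.
apply: reach_sub => //; last exact: tile_center.
by rewrite parent_center.
Qed.

Lemma inside_bounded n : exists N : nat, forall a, is_tile a -> inside n a ->
  forall k, `|a k| <= N%:Z.
Proof.
elim: n => [|n [N IH]].
  by exists 1%N => a _ /inside0 -> [].
exists (3 * N + 9)%N => a ta /insideS ia.
have step b : is_tile b -> inside n (parent b) -> forall k, `|b k| <= (3 * N + 6)%:Z.
  move=> tb ib k; have := IH _ (tile_parent tb) ib k; rewrite /parent; lia.
case: ia => [/(step _ ta) ia k|[j [_ ia]] k]; first by have := ia k; lia.
have := step _ (tile_nbr _ ta) ia k; move: ta; case: k; case: j {ia}; tiling.
Qed.

(** * Edges of the snowflake *)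

(** The vertex of [a] opposite to the edge of direction [k], by its heights. *)
Definition vertex k a : tile :=
  fun j => a j - 1 - tile_sum a + (if same k j then 2 * tile_sum a + 3 else 0).

(** Edges between an inside and an outside tile, oriented with the inside tile
    on the left. *)
Definition boundary n (A B : tile) := exists a k,
  [/\ is_tile a, inside n a, ~~ inside n (nbr k a), A = vertex (next k) a
    & B = vertex (next (next k)) a].

(** The rotation of angle [- pi / 3], on heights. *)
Definition turn_tile (d : tile) : tile := fun i => - d (next (next i)).

Lemma nbr_corner1 k b : is_tile b ->
  nbr k (corner (next k) b) = corner (next (next k)) (nbr k b).
Proof. by move=> tb; apply: tile_ext; case: k; move: tb; subtiling. Qed.

Lemma nbr_corner2 k b : is_tile b ->
  nbr k (corner (next (next k)) b) = corner (next k) (nbr k b).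
Proof. by move=> tb; apply: tile_ext; case: k; move: tb; subtiling. Qed.

Lemma nbr_center1 i b : is_tile b ->
  nbr (next i) (center i b) = middle (next (next i)) b.
Proof. by move=> tb; apply: tile_ext; case: i; move: tb; subtiling. Qed.

Lemma nbr_center2 i b : is_tile b ->
  nbr (next (next i)) (center i b) = middle (next i) b.
Proof. by move=> tb; apply: tile_ext; case: i; move: tb; subtiling. Qed.

Lemma next3 k : next (next (next k)) = k. Proof. by case: k. Qed.

(** The four edges that replace the edge from [A] to [B], in heights for the
    tiling that is three times finer. *)
Definition koch_edge (A B : tile) (i : nat) : tile * tile :=
  let d := fun j => B j - A j in
  let p m := fun j => 3 * A j + m * d j in
  match i with
  | 0 => (p 0, p 1)
  | 1 => (p 1, fun j => p 1 j + turn_tile d j)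
  | 2 => (fun j => p 1 j + turn_tile d j, p 2)
  | _ => (p 2, p 3)
  end.

Ltac vertices := rewrite /vertex /koch_edge /turn_tile; subtiling.

Lemma koch_edge_vertex k a : is_tile a ->
  let A := vertex (next k) a in let B := vertex (next (next k)) a in
  let m := middle k (nbr k a) in
  [/\ koch_edge A B 0 = (vertex (next k) (corner (next k) a),
                         vertex (next (next k)) (corner (next k) a)),
      koch_edge A B 1 = (vertex (next (next k)) m, vertex k m),
      koch_edge A B 2 = (vertex k m, vertex (next k) m)
    & koch_edge A B 3 = (vertex (next k) (corner (next (next k)) a),
                         vertex (next (next k)) (corner (next (next k)) a))].
Proof.
by move=> ta; split; congr pair; apply: tile_ext; case: k; move: ta; vertices.
Qed.

(** The boundary edges follow the Koch substitution. The two end pieces of a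
    boundary edge are edges of corners of the inside tile, and the two middle
    pieces are the free edges of the bump. *)
Lemma boundaryS n (A B : tile) : boundary n.+1 A B <->
  exists A0 B0, boundary n A0 B0 /\ exists i, (i < 4)%N /\ (A, B) = koch_edge A0 B0 i.
Proof.
split=> [[a' [k [ta' ia' oa' -> ->]]]|[_ [_ [[a [k [ta ia oa -> ->]]] [i []]]]]].
  pose b := parent a'; have tb : is_tile b by exact: tile_parent.
  have [i [] ea] := subtileP ta'; rewrite -/b in ea; rewrite ea in ia' oa' *.
  - have ib : inside n b by rewrite -(inside_corner _ i).
    case: (dir_eq_dec i k) => [ik|/dir_neq ik].
      by move: oa'; rewrite -ik nbr_corner// inside_center// ib.
    exists (vertex (next k) b), (vertex (next (next k)) b).
    have [e1 _ _ e4] := koch_edge_vertex k tb.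
    case: ik => ki.
      have {}ki : i = next (next k) by rewrite ki next3.
      split; last by exists 3%N; rewrite e4 -ki.
      exists b, k; split=> //; move: oa'; rewrite ki nbr_corner2//.
      by rewrite inside_corner// tile_nbr.
    have {}ki : i = next k by rewrite ki next3.
    split; last by exists 0%N; rewrite e1 -ki.
    exists b, k; split=> //; move: oa'; rewrite ki nbr_corner1//.
    by rewrite inside_corner// tile_nbr.
  - have ib : inside n b by rewrite -(inside_center _ i).
    exfalso; case: (dir_eq_dec i k) => [ik|/dir_neq[] ik].
    + by move: oa'; rewrite -ik -nbr_corner// nbrK ?tile_corner//
        inside_corner// ib.
    + by move: oa'; rewrite ik nbr_center1// inside_middle// ib.
    + by move: oa'; rewrite ik nbr_center2// inside_middle// ib.
  - have tc := tile_nbr i tb.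
    move: ia'; rewrite inside_middle// => ia'.
    case: (dir_eq_dec i k) => [ik|/dir_neq ik].
      move: oa'; rewrite -ik nbr_middle// inside_middle// nbrK// orbC.
      by rewrite ia'.
    have ob : ~~ inside n b.
      by case: ik oa' => ->; rewrite ?nbr_middle1 ?nbr_middle2// inside_center.
    move: ia'; rewrite (negbTE ob) /= => ic.
    exists (vertex (next i) (nbr i b)), (vertex (next (next i)) (nbr i b)).
    split; first by exists (nbr i b), i; split=> //; rewrite nbrK.
    have [_ e2 e3 _] := koch_edge_vertex i tc; rewrite nbrK// in e2 e3.
    by case: ik => ->; [exists 1%N; rewrite e2|exists 2%N; rewrite e3];
      rewrite next3.
have [e1 e2 e3 e4] := koch_edge_vertex k ta; have tc := tile_nbr k ta.
case: i => [|[|[|[|//]]]] _.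
- rewrite e1 => -[-> ->]; exists (corner (next k) a), k; split=> //.
  + exact: tile_corner.
  + by rewrite inside_corner.
  + by rewrite nbr_corner1// inside_corner.
- rewrite e2 => -[-> ->]; exists (middle k (nbr k a)), (next k).
  rewrite next3; split=> //.
  + exact: tile_middle.
  + by rewrite inside_middle// nbrK// ia orbT.
  + by rewrite nbr_middle1// inside_center.
- rewrite e3 => -[-> ->]; exists (middle k (nbr k a)), (next (next k)).
  rewrite next3; split=> //.
  + exact: tile_middle.
  + by rewrite inside_middle// nbrK// ia orbT.
  + by rewrite nbr_middle2// inside_center.
- rewrite e4 => -[-> ->]; exists (corner (next (next k)) a), k; split=> //.
  + exact: tile_corner.
  + by rewrite inside_corner.
  + by rewrite nbr_corner2// inside_corner.
Qed.

Lemma boundary0 (A B : tile) : boundary 0 A B <->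
  exists k, A = vertex (next k) seed /\ B = vertex (next (next k)) seed.
Proof.
split=> [[a [k [ta /inside0 -> _ -> ->]]]|[k [-> ->]]]; first by exists k.
by exists seed, k; split=> //; case: k.
Qed.

End Tiling.

(** * Surfaces tiled by copies of one triangle *)

Section Tiled.
Variables (Y : topologicalType) (D : set Y) (edge : dir -> set Y).

(** The points where charts of arbitrarily many tiles may meet. *)
Definition cornered : set Y :=
  [set y | exists e f, [/\ e <> f, edge e y & edge f y]].

(** A surface cut into tiles, seen from the charts [tau i] of its tiles: it is
    the quotient of the disjoint union of the tiles, where [sigma e] tells
    which tile lies behind the edge [e]. The condition on identifications
    leaves out the points on two edges, around which the tiles may meet in any
    number. *)
Record tiled (E : topologicalType) (I : Type) (A : set I)
    (tau : I -> Y -> E) (sigma : dir -> I -> I) : Prop := Tiled {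
  tiled_cover : forall z, exists i y, [/\ A i, D y & z = tau i y];
  tiled_sigma : forall e i, A i -> A (sigma e i);
  tiled_sigmaK : forall e i, A i -> sigma e (sigma e i) = i;
  tiled_glue : forall e i y, A i -> D y -> edge e y ->
    tau (sigma e i) y = tau i y;
  tiled_same : forall i j y y', A i -> A j -> D y -> D y' ->
    tau i y = tau j y' -> y = y';
  tiled_inj : forall i j y, A i -> A j -> D y -> ~ cornered y ->
    tau i y = tau j y -> i = j \/ exists e, edge e y /\ j = sigma e i;
  tiled_closed : forall V : set E,
    closed V <-> forall i, A i -> closed (D `&` tau i @^-1` V) }.

Definition only_edge e : set Y :=
  [set y | D y /\ forall f, edge f y -> f = e].

(** The tiles [i] and [sigma e i], glued along [e], without their other
    edges. These are the sheets of the cover. *)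
Definition star (E I : Type) (tau : I -> Y -> E) (sigma : dir -> I -> I)
    e i : set E :=
  [set z | exists y j, [/\ only_edge e y, j = i \/ j = sigma e i & z = tau j y]].

Lemma only_edge_not_cornered e y : only_edge e y -> ~ cornered y.
Proof. by move=> [_ cy] [f [g [fg ef eg]]]; apply: fg; rewrite (cy _ ef) (cy _ eg). Qed.

Lemma only_edge_exists y : D y -> ~ cornered y -> exists e, only_edge e y.
Proof.
move=> Dy ncy; have [[e ey]|ney] := pselect (exists e, edge e y).
  exists e; split=> // f fy; case: (dir_eq_dec f e) => // fe.
  by exfalso; apply: ncy; exists f, e.
by exists D0; split=> // f fy; exfalso; apply: ney; exists f.
Qed.

Hypothesis edge_closed : forall e, closed (D `&` edge e).

Section Star.
Variables (E : topologicalType) (I : Type) (A : set I).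
Variables (tau : I -> Y -> E) (sigma : dir -> I -> I).
Hypothesis tE : tiled A tau sigma.

Lemma starP e i j y : A i -> A j -> D y ->
  star tau sigma e i (tau j y) -> only_edge e y /\ (j = i \/ j = sigma e i).
Proof.
move=> Ai Aj Dy [y' [k [cy' ki ez]]].
have Ak : A k by case: ki => ->//; exact: (tiled_sigma tE).
have yy' : y = y' by apply: (tiled_same tE) ez => //; case: cy'.
subst y'; split=> //.
have [<-//|[f [fy kE]]] := tiled_inj tE Ak Aj Dy (only_edge_not_cornered cy') (esym ez).
have fe : f = e by case: cy' => _; apply.
by rewrite kE fe; case: ki => ->; [right|left; rewrite (tiled_sigmaK tE)].
Qed.

Lemma star_open e i : A i -> open (star tau sigma e i).
Proof.
move=> Ai; rewrite -closedC; apply/(tiled_closed tE) => j Aj.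
have [ji|nji] := pselect (j = i \/ j = sigma e i); last first.
  rewrite (_ : _ `&` _ = D `&` tau j @^-1` setT).
    by apply: (tiled_closed tE _).1 => //; exact: closedT.
  apply/seteqP; split=> y [Dy _]; split=> //= /(starP Ai Aj Dy)[_].
  exact: nji.
rewrite (_ : _ `&` _ = (D `&` edge (next e)) `|` (D `&` edge (next (next e)))).
  exact: closedU.
apply/seteqP; split=> y /=.
  move=> [Dy ns]; apply: contrapT => nf; apply: ns.
  exists y, j; split=> //; split=> // f fy; case: (dir_eq_dec e f) => // ef.
  by exfalso; apply: nf; case: (dir_neq ef) => <-; [left|right].
move=> [] [Dy ey]; split=> // /(starP Ai Aj Dy)[[_ cy] _];
  by have := cy _ ey; case: (e).
Qed.

End Star.

(** A continuous open injection on [V] is a homeomorphism onto its image; the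
    inverse comes from choice. *)
Lemma homeomorphic_image (E B : topologicalType) (p : E -> B) (V : set E)
    (U : set B) :
  continuous p -> V !=set0 -> open V -> p @` V = U ->
  {in V &, injective p} ->
  (forall V', open V' -> V' `<=` V -> open (p @` V')) ->
  maps_homeomorphically p V U.
Proof.
move=> cp [z0 Vz0] oV pV inj_p op.
have /choice[g gP] : forall b, exists z, U b -> V z /\ p z = b.
  move=> b; have [|nUb] := pselect (U b); last by exists z0.
  by rewrite -pV => -[z Vz zb]; exists z.
exists g; split.
- by move=> z Vz; rewrite -pV; exists z.
- by move=> b /gP[].
- move=> z /[dup] Vz; rewrite inE => Vz'.
  have [|Vg pg] := gP (p z); first by rewrite -pV; exists z.
  by apply: inj_p => //; rewrite inE.
- by move=> b; rewrite inE => /gP[].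
split; first exact: continuous_subspaceT.
apply/subspace_continuousP => b Ub N /= nN.
have [Vg pg] := gP _ Ub.
have [W [oW Wg] WN] : exists2 W, open_nbhs (g b) W & W `<=` N.
  by move: nN; rewrite nbhsE.
rewrite /nbhs /= /within /=.
have : nbhs b (p @` (W `&` V)).
  apply: open_nbhs_nbhs; split; last by exists (g b).
  by apply: op; [exact: openI|move=> z []].
apply: filterS => w [z [Wz Vz] <-] Uw.
have [Vg' pg'] := gP _ Uw.
have gpz : g (p z) = z by apply: inj_p => //; rewrite inE.
by have := WN _ Wz; rewrite -{1}gpz.
Qed.

(** The map sends the point [y] of the tile [i] to the point [y] of the tile
    [c i]. A point of [B] that is not cornered lies in some star, whose
    preimage is the union of the stars of the tiles with the right colour.
    They are disjoint because [sigma'] has no fixed point. *)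
Theorem tiled_branched_cover (E B : topologicalType) (I I' : Type)
    (A : set I) (A' : set I') (tau : I -> Y -> E) (tau' : I' -> Y -> B)
    (sigma : dir -> I -> I) (sigma' : dir -> I' -> I') (c : I -> I') :
  tiled A tau sigma -> tiled A' tau' sigma' ->
  finite_set (D `&` cornered) -> finite_set A' ->
  (forall i, A i -> A' (c i)) ->
  (forall e i, A i -> c (sigma e i) = sigma' e (c i)) ->
  (forall j, A' j -> exists i, A i /\ c i = j) ->
  (forall e j, A' j -> sigma' e j <> j) ->
  (forall i j y, A' i -> A' j -> D y -> cornered y -> tau' i y = tau' j y) ->
  is_branched_cover_of E B.
Proof.
move=> tE tB fin_corner finA' cA csigma csurj sigma'_neq tau'_corner.
have /choice[p0 p0P] : forall z, exists w, exists i y,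
    [/\ A i, D y, z = tau i y & w = tau' (c i) y].
  by move=> z; have [i [y [Ai Dy zE]]] := tiled_cover tE z; exists (tau' (c i) y), i, y.
have pE i y : A i -> D y -> p0 (tau i y) = tau' (c i) y.
  move=> Ai Dy; have [j [y' [Aj Dy' eq_tau ->]]] := p0P (tau i y).
  have yy' := tiled_same tE Ai Aj Dy Dy' eq_tau; subst y'.
  have [cy|ncy] := pselect (cornered y).
    by apply: tau'_corner => //; exact: cA.
  have [->//|[e [ey ->]]] := tiled_inj tE Ai Aj Dy ncy eq_tau.
  by rewrite csigma// (tiled_glue tB)//; exact: cA.
move: p0 pE {p0P} => p pE.
have pcont : continuous p.
  apply/continuous_closedP => V cV; apply/(tiled_closed tE) => i Ai.
  have := (tiled_closed tB V).1 cV _ (cA _ Ai).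
  congr closed; apply/seteqP; split=> y /= [Dy].
    by rewrite -pE.
  by rewrite pE.
exists p; split=> //.
  apply/seteqP; split=> // b _.
  have [j [y [Aj Dy ->]]] := tiled_cover tB b.
  have [i [Ai <-]] := csurj _ Aj.
  by exists (tau i y) => //; rewrite pE.
apply: (@sub_finite_set _ _
  (\bigcup_(j in A') (tau' j @` (D `&` cornered)))); last first.
  by apply: bigcup_finite => // j _; exact: finite_image.
move=> b /= nb; apply: contrapT => ncb; apply: nb.
have [r [y [Ar Dy bE]]] := tiled_cover tB b.
have ncy : ~ cornered y.
  by move=> cy; apply: ncb; exists r => //; rewrite bE; exists y.
have [e cey] := only_edge_exists Dy ncy.
have star_sigma i k : A i -> k = i \/ k = sigma e i -> A k.
  by move=> Ai [] -> //; exact: (tiled_sigma tE).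
(* [sigma'] has no fixed point, so the two tiles of a star have distinct
   colours, and [p] is injective on the star. *)
have sheet_inj i k k' x : A i -> only_edge e x -> k = i \/ k = sigma e i ->
    k' = i \/ k' = sigma e i -> tau' (c k) x = tau' (c k') x ->
    tau k x = tau k' x.
  move=> Ai cx ki k'i eq_tau; have Dx := cx.1.
  have Ak := star_sigma _ _ Ai ki; have Ak' := star_sigma _ _ Ai k'i.
  have [->//|k'E] : k' = k \/ k' = sigma e k.
    case: ki => ->; case: k'i => ->; auto.
    by rewrite (tiled_sigmaK tE)//; right.
  rewrite k'E.
  have ck' : c k' = sigma' e (c k) by rewrite k'E csigma.
  have [ckk'|[f [fx _]]] := tiled_inj tB (cA _ Ak) (cA _ Ak') Dx
    (only_edge_not_cornered cx) eq_tau.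
    by exfalso; apply: (sigma'_neq e (c k)); [exact: cA|rewrite -ck'].
  by rewrite (tiled_glue tE)//; have <- := cx.2 _ fx.
have image_open i V' : A i -> open V' -> V' `<=` star tau sigma e i ->
    open (p @` V').
  move=> Ai oV' V's; rewrite -closedC; apply/(tiled_closed tB) => j Aj.
  have [[k [ki jE]]|nk] := pselect (exists k, (k = i \/ k = sigma e i) /\ j = c k).
    have Ak := star_sigma _ _ Ai ki.
    have := (tiled_closed tE (~` V')).1.
    rewrite closedC => /(_ oV' k Ak).
    congr closed; apply/seteqP; split=> x /= [Dx nV]; split=> //.
      move=> [z V'z]; have [x' [k' [cx' k'i zE]]] := V's _ V'z.
      have Ak' := star_sigma _ _ Ai k'i; have Dx' := cx'.1.
      rewrite zE pE// jE => eq_tau.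
      have xx' := tiled_same tB (cA _ Ak') (cA _ Ak) Dx' Dx eq_tau; subst x'.
      apply: nV; rewrite -(sheet_inj i k' k)// -?zE//.
    by move=> V'k; apply: nV; exists (tau k x) => //; rewrite pE// jE.
  rewrite (_ : _ `&` _ = D `&` tau' j @^-1` setT).
    by apply: (tiled_closed tB _).1 => //; exact: closedT.
  apply/seteqP; split=> x [Dx _]; split=> //= -[z V'z].
  have [x' [k' [cx' k'i zE]]] := V's _ V'z.
  have Ak' := star_sigma _ _ Ai k'i; have Dx' := cx'.1.
  rewrite zE pE// => eq_tau.
  have xx' := tiled_same tB (cA _ Ak') Aj Dx' Dx eq_tau; subst x'.
  apply: nk.
  have [<-|[f [fx ->]]] :=
    tiled_inj tB (cA _ Ak') Aj Dx (only_edge_not_cornered cx') eq_tau.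
    by exists k'.
  rewrite (cx'.2 _ fx); exists (sigma e k'); rewrite csigma//; split=> //.
  by case: k'i => ->; [right|left; rewrite (tiled_sigmaK tE)].
have image_star i : A i -> p @` star tau sigma e i = star tau' sigma' e (c i).
  move=> Ai; apply/seteqP; split=> [_ [z [x [k [cx ki ->]]] <-]|_ [x [j [cx ji ->]]]].
    have Ak := star_sigma _ _ Ai ki; rewrite pE//; last exact: cx.1.
    by exists x, (c k); split=> //; case: ki => ->; rewrite ?csigma//; auto.
  have [k [ki ->]] : exists k, (k = i \/ k = sigma e i) /\ j = c k.
    case: ji => ->; first by exists i; auto.
    by exists (sigma e i); rewrite csigma//; auto.
  have Ak := star_sigma _ _ Ai ki.
  by exists (tau k x); [exists x, k|rewrite pE//; exact: cx.1].
exists (star tau' sigma' e r), [set star tau sigma e i | i in A `&` c @^-1` [set r]].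
split.
- split; first exact: (star_open tB).
  by exists y, r; split=> //; left.
- apply/seteqP; split=> [z|z [_ [i [Ai /= ci] <-]]] /=.
    have [i [x [Ai Dx ->]]] := tiled_cover tE z.
    rewrite pE// => /(starP tB Ar (cA _ Ai) Dx)[cx ci].
    case: ci => ci.
      by exists (star tau sigma e i); [exists i|exists x, i; split=> //; left].
    exists (star tau sigma e (sigma e i)).
      exists (sigma e i) => //; split; first exact: (tiled_sigma tE).
      by rewrite /= csigma// ci (tiled_sigmaK tB).
    by exists x, i; split=> //; right; rewrite (tiled_sigmaK tE).
  move=> zi; have : (p @` star tau sigma e i) (p z) by exists z.
  by rewrite image_star// ci.
- move=> _ _ [i [Ai /= ci] <-] [j [Aj /= cj] <-] [_ [[x [k [cx ki ->]]]]].
  have Ak := star_sigma _ _ Ai ki.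
  move=> /(starP tE Aj Ak cx.1)[_ kj].
  suff -> : i = j by [].
  case: ki kj => -> [] // eij.
  + by exfalso; apply: (sigma'_neq e r) => //; rewrite -{2}ci eij csigma// cj.
  + by exfalso; apply: (sigma'_neq e r) => //; rewrite -{2}cj -eij csigma// ci.
  + by rewrite -(tiled_sigmaK tE e Ai) eij (tiled_sigmaK tE).
- by move=> _ [i [Ai _] <-]; exact: (star_open tE).
- move=> _ [i [Ai /= ci] <-]; apply: homeomorphic_image => //.
  + by exists (tau i y), y, i; split=> //; left.
  + exact: (star_open tE).
  + by rewrite image_star// ci.
  + move=> z z'; rewrite !inE => -[x [k [cx ki ->]]] [x' [k' [cx' k'i ->]]].
    have Ak := star_sigma _ _ Ai ki; have Ak' := star_sigma _ _ Ai k'i.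
    have Dx := cx.1; have Dx' := cx'.1.
    rewrite !pE// => eq_tau.
    have xx' := tiled_same tB (cA _ Ak) (cA _ Ak') Dx Dx' eq_tau; subst x'.
    exact: (sheet_inj i).
  + by move=> V'; exact: image_open.
Qed.

End Tiled.

(** * Heights over the three directions of a triangular lattice *)

Section Plane.
Variable R : realType.
Local Notation plane := 'cV[R]_2.
Local Notation s3 := (Num.sqrt 3 : R).
Implicit Types (x y : plane) (f : dir -> R).

Lemma sqrt3_sqr : s3 * s3 = 3.
Proof. by rewrite -expr2 sqr_sqrtr. Qed.

(** Distance, with sign, to the line through the origin of direction [k],
    divided by the height [sqrt 3 / 2] of the unit triangle. *)
Definition hgt k x : R :=
  match k with
  | D0 => 2 * s3 / 3 * x 1 0
  | D1 => - x 0 0 - s3 / 3 * x 1 0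
  | D2 => x 0 0 - s3 / 3 * x 1 0
  end.

Definition of_hgt f : plane := pt (f D2 + f D0 / 2) (s3 / 2 * f D0).

Lemma pt0 (u v : R) : pt u v 0 0 = u. Proof. by rewrite mxE. Qed.
Lemma pt1 (u v : R) : pt u v 1 0 = v. Proof. by rewrite mxE. Qed.

Lemma plane_eq x y : x 0 0 = y 0 0 -> x 1 0 = y 1 0 -> x = y.
Proof.
move=> e0 e1; apply/matrixP => i j; rewrite [j]ord1.
case: i => -[|[|//]] i2.
  by rewrite (_ : Ordinal i2 = 0)//; exact: val_inj.
by rewrite (_ : Ordinal i2 = 1)//; exact: val_inj.
Qed.

Lemma hgt_sum x : hgt D0 x + hgt D1 x + hgt D2 x = 0.
Proof. by rewrite /hgt; field. Qed.

Lemma sqrt3_neq0 : s3 != 0.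
Proof. by rewrite gt_eqF// sqrtr_gt0. Qed.

Lemma hgt_inj x y : (forall k, hgt k x = hgt k y) -> x = y.
Proof.
move=> e; have e0 := e D0; have e2 := e D2; rewrite /hgt in e0 e2.
have e1 : x 1 0 = y 1 0.
  apply: mulfI e0.
  by rewrite !mulf_neq0// ?invr_eq0 ?sqrt3_neq0// pnatr_eq0.
by apply: plane_eq => //; move: e2; rewrite e1 => /addIr.
Qed.

Lemma hgt_of_hgt f k : f D0 + f D1 + f D2 = 0 -> hgt k (of_hgt f) = f k.
Proof.
move=> f0; have f1 : f D1 = - (f D0 + f D2) by lra.
have := sqrt3_sqr; rewrite /hgt /of_hgt !pt0 !pt1; case: k; rewrite ?f1 => s33.
- transitivity (s3 * s3 / 3 * f D0); first by field.
  by rewrite s33; field.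
- transitivity (- f D2 - f D0 / 2 - s3 * s3 / 6 * f D0); first by field.
  by rewrite s33; field.
- transitivity (f D2 + f D0 / 2 - s3 * s3 / 6 * f D0); first by field.
  by rewrite s33; field.
Qed.

Lemma hgtD k x y : hgt k (x + y) = hgt k x + hgt k y.
Proof. by case: k; rewrite /hgt !mxE; field. Qed.

Lemma hgtZ k (t : R) x : hgt k (t *: x) = t * hgt k x.
Proof. by case: k; rewrite /hgt !mxE; field. Qed.

Lemma hgtB k x y : hgt k (x - y) = hgt k x - hgt k y.
Proof. by rewrite hgtD -scaleN1r hgtZ mulN1r. Qed.

Lemma hgt_turn k x : hgt k (turn x) = - hgt (next (next k)) x.
Proof.
have s33 := sqrt3_sqr; case: k; rewrite /next /hgt /turn ?pt0 ?pt1.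
- transitivity (s3 / 3 * x 1 0 - s3 * s3 / 3 * x 0 0); first by field.
  by rewrite s33; field.
- transitivity (- x 0 0 / 2 + s3 * s3 / 6 * x 0 0 - s3 * (2 / 3) * x 1 0).
    by field.
  by rewrite s33; field.
- transitivity (x 0 0 / 2 + s3 * s3 / 6 * x 0 0 + s3 / 3 * x 1 0); first by field.
  by rewrite s33; field.
Qed.

Lemma coord_plane_continuous i : continuous (fun x : plane => x i 0).
Proof. exact: coord_continuous. Qed.

Lemma hgt_continuous k : continuous (hgt k).
Proof.
have [u [v ->]] : exists u v : R,
    hgt k = (fun x => u * x 0 0) + (fun x => v * x 1 0).
  case: k; [exists 0, (2 * s3 / 3)|exists (- 1), (- (s3 / 3))
           |exists 1, (- (s3 / 3))];
    by apply/funext => x; rewrite fctE /hgt; ring.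
move=> x; have c0 := @cvgMl_tmp _ _ _ _ _ u _ (@coord_plane_continuous 0 x).
have c1 := @cvgMl_tmp _ _ _ _ _ v _ (@coord_plane_continuous 1 x).
exact: (cvgD (c0 _) (c1 _)).
Qed.

Lemma of_hgtE f : of_hgt f = f D0 *: pt (1 / 2) (s3 / 2) + f D2 *: pt 1 0.
Proof. by apply: plane_eq; rewrite !mxE /=; field. Qed.

Lemma of_hgt_continuous (T : topologicalType) (f : T -> dir -> R) :
  (forall k, continuous (f ^~ k)) -> continuous (fun t => of_hgt (f t)).
Proof.
move=> cf t.
rewrite (_ : (fun t => _) = (fun t => f t D0 *: pt (1 / 2) (s3 / 2)) +
  (fun t => f t D2 *: pt 1 0)); last first.
  by apply/funext => u; rewrite of_hgtE.
have c0 := @cvgZr_tmp _ _ _ _ _ _ _ (pt (1 / 2) (s3 / 2)) (cf D0 t).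
have c2 := @cvgZr_tmp _ _ _ _ _ _ _ (pt 1 0 : plane) (cf D2 t).
exact: (cvgD (c0 _) (c2 _)).
Qed.

(** * Sides of the Koch polygons *)

Definition koch_sides (s : plane * plane) : seq (plane * plane) :=
  zip (koch_side s) (rcons (behead (koch_side s)) s.2).

(** Each replaced side starts where the previous one ends, so that taking the
    sides commutes with concatenation, even cyclically. *)
Lemma sides_flatten (P : seq plane) :
  sides (flatten [seq koch_side s | s <- sides P]) =
  flatten [seq koch_sides s | s <- sides P].
Proof.
case: P => [//|x P].
rewrite {2 3}/sides rot1_cons.
have chain y z Q : let S := zip (y :: Q) (rcons Q z) in
  exists F, flatten [seq koch_side s | s <- S] = y :: F /\
    zip (y :: F) (rcons F z) = flatten [seq koch_sides s | s <- S].
  elim: Q y => [|w Q IH] y /=; first by eexists; split; reflexivity.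
  have [F [eF zF]] := IH w.
  eexists; split; first by reflexivity.
  rewrite /= in eF zF *; rewrite eF /= -zF /=; reflexivity.
have [F [eF zF]] := chain x x P.
by rewrite eF /sides rot1_cons.
Qed.

End Plane.

Section KochSides.
Variable R : realType.
Local Notation plane := 'cV[R]_2.

Definition node n (F : tile) : plane := of_hgt (fun k => (F k)%:~R / 3 ^+ n).

Lemma hgt_node k n F : tile_sum F = 0 -> hgt k (node n F) = (F k)%:~R / 3 ^+ n.
Proof. by move=> F0; rewrite hgt_of_hgt// -!mulrDl -!intrD -/(tile_sum F) F0 mul0r. Qed.

Lemma tile_sum_vertex k a : is_tile a -> tile_sum (vertex k a) = 0.
Proof. by case: k; rewrite /vertex /is_tile /tile_sum /=; lia. Qed.

Lemma expr3_neq0 n : (3 ^+ n : R) != 0.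
Proof. by rewrite expf_neq0// pnatr_eq0. Qed.

Lemma koch_sides_node n (A B : tile) : tile_sum A = 0 -> tile_sum B = 0 ->
  koch_sides (node n A, node n B) =
  [seq (node n.+1 (koch_edge A B i).1, node n.+1 (koch_edge A B i).2) | i <- iota 0 4].
Proof.
move=> zA zB; rewrite /koch_sides /koch_side /=.
have t0 := expr3_neq0 n.
have hgtn m : tile_sum (fun j => 3 * A j + m * (B j - A j)) = 0.
  by move: zA zB; rewrite /tile_sum; lia.
have HT : tile_sum (fun j => 3 * A j + 1 * (B j - A j) +
    turn_tile (fun j => B j - A j) j) = 0.
  by move: zA zB; rewrite /tile_sum /turn_tile /=; lia.
have e0 : node n A = node n.+1 (fun j => 3 * A j + 0 * (B j - A j)).
  apply: hgt_inj => k; rewrite !hgt_node//.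
  by rewrite !(intrD, intrM, intrB) exprS; field.
have e1 : node n A + 3^-1 *: (node n B - node n A) =
    node n.+1 (fun j => 3 * A j + 1 * (B j - A j)).
  apply: hgt_inj => k; rewrite hgtD hgtZ hgtB !hgt_node//.
  by rewrite !(intrD, intrM, intrB) exprS; field.
have e2 : node n A + 3^-1 *: (node n B - node n A) +
      turn (3^-1 *: (node n B - node n A)) =
    node n.+1 (fun j => 3 * A j + 1 * (B j - A j) +
      turn_tile (fun j => B j - A j) j).
  apply: hgt_inj => k; rewrite !hgtD hgt_turn !hgtZ !hgtB !hgt_node//.
  by rewrite /turn_tile !(intrD, intrM, intrB, intrN) exprS; field.
have e3 : node n A + 2 *: (3^-1 *: (node n B - node n A)) =
    node n.+1 (fun j => 3 * A j + 2 * (B j - A j)).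
  apply: hgt_inj => k; rewrite hgtD !hgtZ hgtB !hgt_node//.
  by rewrite !(intrD, intrM, intrB) exprS; field.
have e4 : node n B = node n.+1 (fun j => 3 * A j + 3 * (B j - A j)).
  apply: hgt_inj => k; rewrite !hgt_node//.
  by rewrite !(intrD, intrM, intrB) exprS; field.
by rewrite e2 e1 e3 e0 e4.
Qed.

Lemma tile_sum_boundary n A B : boundary n A B -> tile_sum A = 0 /\ tile_sum B = 0.
Proof. by move=> [a [k [ta _ _ -> ->]]]; rewrite !tile_sum_vertex. Qed.

Lemma sides_KS n (P Q : plane) : (P, Q) \in sides (KS R n) <->
  exists A B, [/\ boundary n A B, P = node n A & Q = node n B].
Proof.
elim: n P Q => [|n IH] P Q.
  have eD1 : node 0 (vertex D1 seed) = pt 0 0.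
    by rewrite /node /of_hgt; congr pt; rewrite /vertex /seed /tile_sum /= ; field.
  have eD2 : node 0 (vertex D2 seed) = pt 1 0.
    by rewrite /node /of_hgt; congr pt; rewrite /vertex /seed /tile_sum /= ; field.
  have eD0 : node 0 (vertex D0 seed) = pt (1 / 2) (Num.sqrt 3 / 2).
    by rewrite /node /of_hgt; congr pt; rewrite /vertex /seed /tile_sum /= ; field.
  have -> : sides (KS R 0) = [seq (node 0 (vertex (next k) seed),
      node 0 (vertex (next (next k)) seed)) | k <- [:: D0; D1; D2]].
    by rewrite /= eD0 eD1 eD2.
  split; last first.
    move=> [A [B [/boundary0[k [-> ->]] -> ->]]].
    by case: k; rewrite !inE eqxx ?orbT.
  rewrite !inE => /or3P[] /eqP[-> ->]; [set k := D0|set k := D1|set k := D2];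
    exists (vertex (next k) seed), (vertex (next (next k)) seed); split=> //;
    apply/boundary0; by exists k.
rewrite [KS R n.+1]/= sides_flatten; split.
  move=> /flatten_mapP[[P0 Q0]] /IH[A [B [AB -> ->]]].
  have [zA zB] := tile_sum_boundary AB.
  rewrite koch_sides_node// => /mapP[i]; rewrite mem_iota => i4 [-> ->].
  exists (koch_edge A B i).1, (koch_edge A B i).2; split=> //.
  by apply/boundaryS; exists A, B; split=> //; exists i; split=> //; case: koch_edge.
move=> [A [B [/boundaryS[A0 [B0 [AB0 [i [i4 AB]]]]] -> ->]]].
have [zA zB] := tile_sum_boundary AB0.
apply/flatten_mapP; exists (node n A0, node n B0); first by apply/IH; exists A0, B0.
rewrite koch_sides_node//; apply/mapP; exists i; first by rewrite mem_iota.
by rewrite -AB.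
Qed.

End KochSides.

(** * The dihedral group of order 6 *)

Definition addd k l := match k with D0 => l | D1 => next l | D2 => next (next l) end.
Definition oppd k := match k with D0 => D0 | D1 => D2 | D2 => D1 end.

(** The symmetries of the three directions, as affine maps of the integers
    modulo 3: [(b, j)] is [k |-> j - k] if [b] holds and [k |-> j + k]
    otherwise. *)
Definition dih := (bool * dir)%type.
Definition act (r : dih) k := addd r.2 (if r.1 then oppd k else k).
Definition muld (r q : dih) : dih := (r.1 (+) q.1, act r q.2).
Definition invd (r : dih) : dih := (r.1, if r.1 then r.2 else oppd r.2).
(** The symmetry that fixes [k] and exchanges the other two directions. *)
Definition refl k : dih := (true, oppd k).
Definition oned : dih := (false, D0).

Lemma muldA r q t : muld r (muld q t) = muld (muld r q) t.
Proof. by case: r q t => [[] []] [[] []] [[] []]. Qed.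
Lemma muld1 r : muld r oned = r. Proof. by case: r => [[] []]. Qed.
Lemma muldV r : muld r (invd r) = oned. Proof. by case: r => [[] []]. Qed.
Lemma mulVd r : muld (invd r) r = oned. Proof. by case: r => [[] []]. Qed.
Lemma reflK k : muld (refl k) (refl k) = oned. Proof. by case: k. Qed.

Lemma finite_dir : finite_set [set: dir].
Proof.
apply: (@sub_finite_set _ _ ([set D0] `|` ([set D1] `|` [set D2]))).
  by case=> _; [left|right; left|right; right].
by rewrite !finite_setU; do !split; exact: finite_set1.
Qed.

Lemma finite_dih : finite_set [set: dih].
Proof.
apply: (@sub_finite_set _ _ ([set: bool] `*` [set: dir])); first by [].
by apply: finite_setX; [exact: finite_finset|exact: finite_dir].
Qed.

Section Rho.
Variable R : realType.
Local Notation plane := 'cV[R]_2.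
Local Notation s3 := (Num.sqrt 3 : R).

Definition mx2 (a b c d : R) : 'M[R]_2 := \matrix_(i, j)
  if i == 0 then if j == 0 then a else b else if j == 0 then c else d.

Lemma mx2P (M N : 'M[R]_2) : M 0 0 = N 0 0 -> M 0 1 = N 0 1 ->
  M 1 0 = N 1 0 -> M 1 1 = N 1 1 -> M = N.
Proof.
move=> e1 e2 e3 e4; apply/matrixP.
have I (i : 'I_2) : i = 0 \/ i = 1.
  by case: i => -[|[|//]] i2; [left|right]; exact: val_inj.
by move=> i j; case: (I i) => ->; case: (I j) => ->.
Qed.

Lemma mx2M a b c d a' b' c' d' : mx2 a b c d * mx2 a' b' c' d' =
  mx2 (a * a' + b * c') (a * b' + b * d') (c * a' + d * c') (c * b' + d * d').
Proof.
by apply: mx2P; rewrite !mxE !big_ord_recl big_ord0 addr0 !mxE.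
Qed.

Definition cosd k : R := match k with D0 => 1 | _ => - 1 / 2 end.
Definition sind k : R := match k with D0 => 0 | D1 => s3 / 2 | D2 => - s3 / 2 end.

(** The linear isometry that permutes like [r] the unit vectors [unitvec] of
    angles 0, 2 pi / 3 and 4 pi / 3. *)
Definition rho (r : dih) : 'M[R]_2 :=
  if r.1 then mx2 (cosd r.2) (sind r.2) (sind r.2) (- cosd r.2)
  else mx2 (cosd r.2) (- sind r.2) (sind r.2) (cosd r.2).

Lemma cosdD k l : cosd (addd k l) = cosd k * cosd l - sind k * sind l.
Proof.
have s33 := sqrt3_sqr R; case: k; case: l; rewrite /cosd /sind /=; lra.
Qed.

Lemma sindD k l : sind (addd k l) = sind k * cosd l + cosd k * sind l.
Proof.
have s33 := sqrt3_sqr R; case: k; case: l; rewrite /cosd /sind /=; lra.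
Qed.

Lemma cosdN k : cosd (oppd k) = cosd k. Proof. by case: k. Qed.
Lemma sindN k : sind (oppd k) = - sind k.
Proof. by case: k; rewrite /= ?oppr0 ?mulNr ?opprK. Qed.

Lemma rhoM r q : rho (muld r q) = rho r * rho q.
Proof.
case: r q => [[] k] [[] l]; rewrite /rho /muld /act /= mx2M cosdD sindD
  ?cosdN ?sindN; congr mx2; ring.
Qed.

Lemma rho1 : rho oned = 1.
Proof. by apply: mx2P; rewrite !mxE /= ?oppr0. Qed.

Lemma rho_unit r : rho r \is a GRing.unit.
Proof.
by apply/unitrP; exists (rho (invd r)); rewrite -!rhoM mulVd muldV rho1.
Qed.

Lemma rhoV r : (rho r)^-1 = rho (invd r).
Proof.
by apply: (mulrI (rho_unit r)); rewrite divrr ?rho_unit// -rhoM muldV rho1.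
Qed.

Lemma rho_inj : injective rho.
Proof.
move=> r q e; have s0 : 0 < s3 by rewrite sqrtr_gt0.
have e00 : rho r 0 0 = rho q 0 0 by rewrite e.
have e10 : rho r 1 0 = rho q 1 0 by rewrite e.
have e01 : rho r 0 1 = rho q 0 1 by rewrite e.
have e11 : rho r 1 1 = rho q 1 1 by rewrite e.
move: e00 e01 e10 e11; case: r q {e} => [[] []] [[] []] //;
  rewrite /rho /mx2 !mxE /=; move: s3 s0 => s s0 *; exfalso; lra.
Qed.

Definition unitvec k : plane := pt (cosd k) (sind k).

Lemma linrefl_scaled k (t : R) : t != 0 ->
  linrefl (t *: unitvec k) = rho (refl k).
Proof.
move=> t0; have s33 := sqrt3_sqr R.
have nrm : ((t *: unitvec k)^T *m (t *: unitvec k)) 0 0 = t ^+ 2.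
  rewrite !mxE !big_ord_recl big_ord0 !mxE /=.
  transitivity (t ^+ 2 * (cosd k * cosd k + sind k * sind k)); first by ring.
  rewrite (_ : cosd k * cosd k + sind k * sind k = 1) ?mulr1//.
  by case: k; rewrite /= ; lra.
rewrite /linrefl nrm /rho /refl /= cosdN sindN.
have cc : 2 * (cosd k * cosd k) - 1 = cosd k by case: (k); rewrite /=; lra.
have ss : 2 * (sind k * sind k) - 1 = - cosd k by case: (k); rewrite /=; lra.
have cs : 2 * (cosd k * sind k) = - sind k by case: (k); rewrite /=; lra.
apply: mx2P; rewrite !mxE !big_ord_recl big_ord0 !mxE /=.
- by rewrite -[RHS]cc; field.
- by rewrite -[RHS]cs; field.
- by rewrite -[RHS]cs; field.
- by rewrite -[RHS]ss; field.
Qed.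

Lemma hgt_unitvec k i : hgt i (unitvec k) =
  (same (next (next k)) i)%:R - (same (next k) i)%:R.
Proof.
have s33 := sqrt3_sqr R.
by case: k; case: i; rewrite /hgt /unitvec ?pt0 ?pt1 /=; lra.
Qed.

Lemma boundary_refl n a k : is_tile a ->
  side_refl (node R n (vertex (next k) a), node R n (vertex (next (next k)) a)) =
  rho (refl k).
Proof.
move=> ta; have t0 := expr3_neq0 R n.
rewrite /side_refl /=.
rewrite -(linrefl_scaled k (t := (- tile_sign a)%:~R / 3 ^+ n)); last first.
  rewrite mulf_neq0// ?invr_eq0// intr_eq0.
  by move: ta; rewrite /tile_sign /is_tile; lia.
congr linrefl; apply: hgt_inj => i.
rewrite hgtB hgtZ !hgt_node ?tile_sum_vertex// hgt_unitvec.
rewrite /vertex /tile_sign !(intrD, intrN, intrM).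
by case: k; case: i => /=; rewrite ?(intrD, intrM); field.
Qed.

Lemma boundary_direction n k : exists a,
  [/\ is_tile a, inside n a & ~~ inside n (nbr k a)].
Proof.
elim: n => [|n [a [ta ia oa]]]; first by exists seed; case: k.
exists (corner (next k) a); rewrite tile_corner// inside_corner//; split=> //.
by rewrite nbr_corner1// inside_corner// tile_nbr.
Qed.

(** All three directions occur among the sides, and the rotations are products
    of two of their reflections. *)
Lemma dihedral_KS n : dihedral (KS R n) = range rho.
Proof.
apply/seteqP; split=> [M|_ [r _ <-]].
  apply; split; last first.
    move=> _ [[P Q] /sides_KS[A [B [[a [k [ta _ _ -> ->]]] -> ->]]] ->].
    by exists (refl k) => //; rewrite boundary_refl.
  split; first by exists oned => //; exact: rho1.
  move=> _ _ [r _ <-] [q _ <-]; exists (muld r (invd q)) => //.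
  by rewrite rhoM rhoV.
move=> G [[G1 Gdiv] GS].
have Grefl k : G (rho (refl k)).
  apply: GS; have [a [ta ia oa]] := boundary_direction n k.
  exists (node R n (vertex (next k) a), node R n (vertex (next (next k)) a)).
    apply/sides_KS; exists (vertex (next k) a), (vertex (next (next k)) a).
    by split=> //; exists a, k.
  by rewrite boundary_refl.
have Gmul k l : G (rho (muld (refl k) (refl l))).
  have := Gdiv _ _ (Grefl k) (Grefl l).
  by rewrite rhoV -rhoM; case: (l).
case: r => [[] j]; first by have := Grefl (oppd j); case: j.
by have := Gmul D0 j; case: j.
Qed.

End Rho.

(** * Cells of the tiling and the region bounded by a Koch polygon *)

Section Cells.
Variable R : realType.
Variable n : nat.
Local Notation plane := 'cV[R]_2.
Implicit Types (a b : tile) (k i : dir) (x y : plane).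

Definition hgtn k x : R := 3 ^+ n * hgt k x.

Lemma hgtn_sum x : hgtn D0 x + hgtn D1 x + hgtn D2 x = 0.
Proof. by rewrite /hgtn -!mulrDr hgt_sum mulr0. Qed.

Lemma hgtn_continuous k : continuous (hgtn k).
Proof.
move=> x; have c := @cvgMl_tmp _ _ _ _ _ (3 ^+ n) _ (@hgt_continuous R k x).
exact: c _.
Qed.

Definition of_hgtn (f : dir -> R) : plane := of_hgt (fun k => f k / 3 ^+ n).

Lemma hgtn_of_hgtn k f : f D0 + f D1 + f D2 = 0 -> hgtn k (of_hgtn f) = f k.
Proof.
move=> f0; have t0 := expr3_neq0 R n.
rewrite /hgtn hgt_of_hgt; last by rewrite -!mulrDl f0 mul0r.
by rewrite mulrC divfK.
Qed.

Lemma hgtn_inj x y : (forall k, hgtn k x = hgtn k y) -> x = y.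
Proof.
move=> e; apply: hgt_inj => k; exact: (mulfI (expr3_neq0 R n) (e k)).
Qed.

Definition cell a : set plane :=
  [set x | forall k, (a k)%:~R <= hgtn k x <= (a k)%:~R + 1].

Definition open_cell a : set plane :=
  [set x | forall k, (a k)%:~R < hgtn k x < (a k)%:~R + 1].

Lemma open_cellW a x : open_cell a x -> cell a x.
Proof. by move=> ax k; have /andP[/ltW -> /ltW ->] := ax k. Qed.

Lemma lez_of_le_lt (u v : int) (z : R) : u%:~R <= z -> z < v%:~R + 1 -> u <= v.
Proof.
by move=> uz zv; rewrite -ltzD1 -(ltr_int R) intrD; exact: le_lt_trans zv.
Qed.

Lemma lez_of_lt_le (u v : int) (z : R) : u%:~R < z -> z <= v%:~R + 1 -> u <= v.
Proof.
by move=> uz zv; rewrite -ltzD1 -(ltr_int R) intrD; exact: lt_le_trans zv.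
Qed.

Lemma cell_strict_eq a b k x : cell b x ->
  (a k)%:~R < hgtn k x < (a k)%:~R + 1 -> b k = a k.
Proof.
move=> bx /andP[ax1 ax2]; have /andP[bx1 bx2] := bx k.
by apply/eqP; rewrite eq_le (lez_of_le_lt bx1 ax2) (lez_of_lt_le ax1 bx2).
Qed.

Lemma open_cell_eq a b x : open_cell a x -> cell b x -> b = a.
Proof. by move=> ax bx; apply/funext => k; exact: cell_strict_eq (ax k). Qed.

Lemma nbr_off k i a : i <> k -> nbr k a i = a i.
Proof. by case: k; case: i. Qed.

Lemma nbr_on k a : is_tile a ->
  (tile_sum a = -1 /\ nbr k a k = a k - 1) \/
  (tile_sum a = -2 /\ nbr k a k = a k + 1).
Proof. by case: k; rewrite /is_tile /nbr /=; lia. Qed.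

Lemma two_cells a b k x : is_tile a -> is_tile b -> cell b x ->
  (forall i, i <> k -> (a i)%:~R < hgtn i x < (a i)%:~R + 1) ->
  b = a \/ b = nbr k a.
Proof.
move=> ta tb bx ax.
have e i : i <> k -> b i = a i by move=> ik; exact: cell_strict_eq (ax _ ik).
have [bk|bk] : b k = a k \/ b k = nbr k a k.
  have e1 : b (next k) = a (next k) by apply: e; case: (k).
  have e2 : b (next (next k)) = a (next (next k)) by apply: e; case: (k).
  by move: ta tb e1 e2;
    rewrite /is_tile /nbr /tile_sum; case: (k) => /=; lia.
- by left; apply/funext => i; case: (dir_eq_dec i k) => [->//|/e].
- right; apply/funext => i; case: (dir_eq_dec i k) => [->//|ik].
  by rewrite nbr_off// e.
Qed.

(** A walk from [a] to [b] through adjacent cells that contain [x]. Floors of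
    the same height differ by at most 1, and the sums of the floors tell which
    floor of [a] can be moved towards that of [b]. *)
Lemma cell_linked x (P : tile -> Prop) :
  (forall a k, is_tile a -> cell a x -> cell (nbr k a) x -> P a -> P (nbr k a)) ->
  forall a b, is_tile a -> is_tile b -> cell a x -> cell b x -> P a -> P b.
Proof.
move=> step a b ta tb + bx.
have [m] : exists m : nat,
    `|a D0 - b D0| + `|a D1 - b D1| + `|a D2 - b D2| <= m%:Z.
  by exists (absz (`|a D0 - b D0| + `|a D1 - b D1| + `|a D2 - b D2|)); lia.
elim: m a ta => [|m IH] a ta dm ax Pa.
  by rewrite (_ : b = a)//; apply: tile_ext; lia.
have [dm'|dm'] := leP (`|a D0 - b D0| + `|a D1 - b D1| + `|a D2 - b D2|) m%:Z.
  exact: (IH a).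
have near k : a k <= b k + 1 /\ b k <= a k + 1.
  have /andP[a1 a2] := ax k; have /andP[b1 b2] := bx k.
  split; rewrite -(ler_int R) intrD; lra.
have [k bk] : exists k, b k = nbr k a k /\ b k <> a k.
  have n0 := near D0; have n1 := near D1; have n2 := near D2.
  have : (b D0 = nbr D0 a D0 /\ b D0 <> a D0) \/
         (b D1 = nbr D1 a D1 /\ b D1 <> a D1) \/
         (b D2 = nbr D2 a D2 /\ b D2 <> a D2).
    by move: ta tb; rewrite /is_tile /nbr /tile_sum /=; lia.
  by case=> [|[]] ?; [exists D0|exists D1|exists D2].
have cx : cell (nbr k a) x.
  move=> i; case: (dir_eq_dec i k) => [->|ik]; last by rewrite nbr_off.
  by rewrite -bk.1; exact: bx.
apply: (IH (nbr k a)) => //; [exact: tile_nbr| |exact: step].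
move: bk dm; have := near k.
case: (k); rewrite /nbr /=; lia.
Qed.

(** If the floors sum to 0, the point is a node of the lattice and one of the
    floors has to be lowered. *)
Lemma cell_cover x : exists a, is_tile a /\ cell a x.
Proof.
have := hgtn_sum x; set u := hgtn D0 x; set v := hgtn D1 x; set w := hgtn D2 x => s0.
have := floor_itv u; have := floor_itv w.
set p := Num.floor u; set q := Num.floor w.
rewrite !intrD => /andP[q1 q2] /andP[p1 p2].
have [hv|hv] := leP (- p%:~R - q%:~R - 1) v.
  exists (fun k => match k with D0 => p | D1 => - p - q - 1 | D2 => q end).
  split; first by rewrite /is_tile /tile_sum; lia.
  by case; rewrite -/u -/v -/w ?(intrD, intrN, intrB); apply/andP; split; lra.
exists (fun k => match k with D0 => p | D1 => - p - q - 2 | D2 => q end).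
split; first by rewrite /is_tile /tile_sum; lia.
by case; rewrite -/u -/v -/w ?(intrD, intrN, intrB); apply/andP; split; lra.
Qed.

Lemma hgtn_node k F : tile_sum F = 0 -> hgtn k (node R n F) = (F k)%:~R.
Proof.
have t0 : (0 : R) < 3 ^+ n by rewrite exprn_gt0.
by move=> F0; rewrite /hgtn hgt_node// mulrC divfK ?gt_eqF.
Qed.

Lemma dir_from k (T : dir -> Prop) :
  T k -> T (next k) -> T (next (next k)) -> forall i, T i.
Proof. by case: k => ? ? ? []. Qed.

Lemma vertex_along k a (z := a k - 1 - tile_sum a) (u := a (next k) - 1 - tile_sum a)
    (v := a (next (next k)) - 1 - tile_sum a) (s := 2 * tile_sum a + 3) :
  [/\ vertex (next k) a k = z /\ vertex (next (next k)) a k = z,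
      vertex (next k) a (next k) = u + s /\ vertex (next (next k)) a (next k) = u
    & vertex (next k) a (next (next k)) = v /\
      vertex (next (next k)) a (next (next k)) = v + s].
Proof.
by rewrite /z /u /v /s {z u v s} /vertex; case: k; split; split; rewrite /= ?addr0.
Qed.

(** On the line of the edge the other two heights have a constant sum, so that
    the segment fills the intersection of the two cells. *)
Lemma edgeP a k x : is_tile a ->
  segment (node R n (vertex (next k) a)) (node R n (vertex (next (next k)) a)) x <->
  cell a x /\ cell (nbr k a) x.
Proof.
move=> ta; set A := vertex (next k) a; set B := vertex (next (next k)) a.
have Hseg i (t : R) : hgtn i (node R n A + t *: (node R n B - node R n A)) =
    (A i)%:~R + t * ((B i)%:~R - (A i)%:~R).
  rewrite -!hgtn_node ?tile_sum_vertex// /hgtn hgtD hgtZ hgtB.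
  by rewrite mulrDr mulrCA mulrBr.
have [[Ak Bk] [A1 B1] [A2 B2]] := vertex_along k a.
rewrite -/A -/B in Ak Bk A1 B1 A2 B2.
have n1 : nbr k a (next k) = a (next k) by apply: nbr_off; case: (k).
have n2 : nbr k a (next (next k)) = a (next (next k)) by apply: nbr_off; case: (k).
have sum_a : (a k)%:~R + (a (next k))%:~R + (a (next (next k)))%:~R =
    (tile_sum a)%:~R :> R.
  by rewrite -!intrD; congr (_%:~R); rewrite /tile_sum; case: (k) => /=; ring.
split.
  move=> [t]; rewrite /= in_itv /= => /andP[t0 t1] <-.
  by split; apply: (dir_from (k := k)); rewrite Hseg;
    rewrite ?Ak ?Bk ?A1 ?B1 ?A2 ?B2 ?n1 ?n2;
    have [[-> bk]|[-> bk]] := nbr_on k ta; rewrite ?bk !(intrD, intrN, intrM);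
    apply/andP; split; lra.
move=> [ax cx].
have sum_x : hgtn k x + hgtn (next k) x + hgtn (next (next k)) x = 0.
  by have := hgtn_sum x; case: (k) => /=; lra.
have xk : hgtn k x = (A k)%:~R.
  have := cx k; have := ax k; rewrite Ak.
  have [[-> ->]|[-> ->]] := nbr_on k ta; rewrite !(intrD, intrN);
    move=> /andP[? ?] /andP[? ?]; lra.
exists (if tile_sum a == -1 then hgtn (next (next k)) x - (a (next (next k)))%:~R
  else (a (next (next k)))%:~R + 1 - hgtn (next (next k)) x).
  by have := ax (next (next k)); rewrite /= in_itv /=; case: ifP => _; lra.
apply: hgtn_inj; apply: (dir_from (k := k)); rewrite Hseg.
- by rewrite Bk -Ak subrr mulr0 addr0.
- rewrite A1 B1; move: sum_a sum_x; rewrite xk Ak.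
  have [[-> _]|[-> _]] := nbr_on k ta; rewrite /= !(intrD, intrN, intrM);
    lra.
- rewrite A2 B2; have [[-> _]|[-> _]] := nbr_on k ta;
    rewrite /= !(intrD, intrN, intrM); ring.
Qed.

Lemma curveP x : curve (KS R n) x <-> exists a k,
  [/\ is_tile a, inside n a, ~~ inside n (nbr k a), cell a x &
      cell (nbr k a) x].
Proof.
split.
  move=> [[P Q] /sides_KS[A [B [[a [k [ta ia oa -> ->]]] -> ->]]]] /=.
  by move=> /(edgeP _ _ ta)[ax cx]; exists a, k.
move=> [a [k [ta ia oa ax cx]]].
exists (node R n (vertex (next k) a), node R n (vertex (next (next k)) a)).
  by apply/sides_KS; exists (vertex (next k) a), (vertex (next (next k)) a);
    split=> //; exists a, k.
exact/(edgeP _ _ ta).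
Qed.

Lemma curve_cells x : ~ curve (KS R n) x -> forall a b, is_tile a -> is_tile b ->
  cell a x -> cell b x -> inside n a -> inside n b.
Proof.
move=> nx a b ta tb ax bx ia.
apply: (cell_linked (P := inside n) _ ta tb ax bx ia) => {ta ax ia} a k ta ax cx ia.
by apply: contrapT => /negP oa; apply: nx; apply/curveP; exists a, k.
Qed.

Lemma open_cell_curve a x : is_tile a -> open_cell a x -> ~ curve (KS R n) x.
Proof.
move=> ta ax /curveP[b [k [tb ib ob bx cx]]].
by move: ob; rewrite (open_cell_eq ax cx) -(open_cell_eq ax bx) ib.
Qed.

Definition centroid a : plane :=
  of_hgtn (fun k => (a k)%:~R - (tile_sum a)%:~R / 3).

Lemma hgtn_centroid k a : hgtn k (centroid a) = (a k)%:~R - (tile_sum a)%:~R / 3.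
Proof. by rewrite hgtn_of_hgtn// /tile_sum !intrD; field. Qed.

Lemma centroid_cell a : is_tile a -> open_cell a (centroid a).
Proof.
move=> ta k; rewrite hgtn_centroid; move: ta => /orP[] /eqP ->;
  rewrite ?intrN; apply/andP; split; lra.
Qed.

(** Segments are connected. *)
Lemma segment_sub_component x y : (forall z, segment x y z -> ~ curve (KS R n) z) ->
  connected_component (~` curve (KS R n)) x y.
Proof.
move=> sub; exists (segment x y); last first.
  by exists 1; [rewrite /= in_itv /= ler01 lexx|rewrite scale1r addrC subrK].
split.
- by exists 0; [rewrite /= in_itv /= ler01 lexx|rewrite scale0r addr0].
- exact: sub.
apply: connected_continuous_connected; first exact: segment_connected.
apply: continuous_subspaceT => t.
have c1 := @cvgZr_tmp _ _ _ _ _ _ _ (y - x) (@cvg_id _ (nbhs t)).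
exact: (cvgD (cvg_cst x) (c1 _)).
Qed.

Lemma hgtn_segment k t x y :
  hgtn k (x + t *: (y - x)) = hgtn k x + t * (hgtn k y - hgtn k x).
Proof. by rewrite /hgtn hgtD hgtZ hgtB; ring. Qed.

Lemma centroid_component a x : is_tile a -> cell a x -> ~ curve (KS R n) x ->
  connected_component (~` curve (KS R n)) x (centroid a).
Proof.
move=> ta ax nx; apply: segment_sub_component => z [t].
rewrite /= in_itv /= => /andP[t0 t1] <-.
have [->|tn0] := eqVneq t 0; first by rewrite scale0r addr0.
have tp : 0 < t by rewrite lt_neqAle eq_sym tn0.
apply: (@open_cell_curve a) => // k; rewrite hgtn_segment.
have /andP[c1 c2] := centroid_cell ta k; have /andP[a1 a2] := ax k.
have e1 : 0 < t * (hgtn k (centroid a) - (a k)%:~R) by rewrite mulr_gt0// subr_gt0.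
have e2 : 0 < t * ((a k)%:~R + 1 - hgtn k (centroid a)) by rewrite mulr_gt0// subr_gt0.
have e3 : 0 <= (1 - t) * (hgtn k x - (a k)%:~R) by rewrite mulr_ge0// subr_ge0.
have e4 : 0 <= (1 - t) * ((a k)%:~R + 1 - hgtn k x) by rewrite mulr_ge0// subr_ge0.
by apply/andP; split; nra.
Qed.

(** The segments from the midpoint of the common edge to both centres avoid
    the curve, because the edge separates two outside tiles. *)
Lemma link_component a b : link n a b ->
  connected_component (~` curve (KS R n)) (centroid a) (centroid b).
Proof.
move=> [ta oa ob [k eb]]; subst b.
(* the heights of the midpoint of the common edge *)
pose f i : R := if same k i then (a k)%:~R - 1 - (tile_sum a)%:~R
  else (a i)%:~R + 1 / 2.
have f0 : f D0 + f D1 + f D2 = 0.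
  rewrite /f; move: ta; rewrite /is_tile => /orP[] /eqP e; rewrite e;
  move: e => /(congr1 (fun z : int => z%:~R : R)); rewrite /tile_sum;
  by case: (k); rewrite /= ?(intrD, intrN, intrB, intrM); lra.
pose m := of_hgtn f.
have Hm i : hgtn i m = f i by rewrite hgtn_of_hgtn.
have am i : i <> k -> (a i)%:~R < hgtn i m < (a i)%:~R + 1.
  move=> ik; rewrite Hm /f (_ : same k i = false); last first.
    by case: (k) ik; case: (i).
  by apply/andP; split; lra.
have Hk : hgtn k m = (a k)%:~R - 1 - (tile_sum a)%:~R by rewrite Hm /f; case: (k).
have ma : cell a m.
  move=> i; case: (dir_eq_dec i k) => [->|/am/andP[/ltW -> /ltW ->]//].
  rewrite Hk; move: ta => /orP[] /eqP ->; rewrite ?intrN; apply/andP; split; lra.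
have mb : cell (nbr k a) m.
  move=> i; case: (dir_eq_dec i k) => [->|ik]; last first.
    by rewrite nbr_off//; have /andP[/ltW -> /ltW ->] := am _ ik.
  rewrite Hk; have [[-> ->]|[-> ->]] := nbr_on k ta; rewrite ?(intrD, intrN);
    apply/andP; split; lra.
have nm : ~ curve (KS R n) m.
  move=> /curveP[b [j [tb ib _ bm _]]].
  have [ba|ba] := two_cells ta tb bm am; first by move: oa; rewrite -ba ib.
  by move: ob; rewrite -ba ib.
apply: (@connected_component_trans _ _ m); last first.
  exact: centroid_component (tile_nbr k ta) mb nm.
exact/connected_component_sym/centroid_component.
Qed.

Lemma reach_component a b : is_tile a -> reach n a b ->
  connected_component (~` curve (KS R n)) (centroid a) (centroid b).
Proof.
move=> ta r; have : is_tile b /\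
  connected_component (~` curve (KS R n)) (centroid a) (centroid b).
  elim: (clos_rt_rtn1 _ _ _ _ r) => [|b' c l _ [tb ab]].
    split=> //; apply: connected_component_refl.
    exact: open_cell_curve ta (centroid_cell ta).
  have [_ _ _ [k ce]] := l.
  split; first by rewrite ce; exact: tile_nbr.
  by apply: connected_component_trans ab _; exact: link_component.
by case.
Qed.

End Cells.

Section Region.
Variable R : realType.
Variable n : nat.
Local Notation plane := 'cV[R]_2.
Local Notation hgtn := (@hgtn R n).
Local Notation cell := (@cell R n).
Local Notation open_cell := (@open_cell R n).
Local Notation centroid := (centroid R n).
Implicit Types (a b : tile) (k : dir) (x y : plane).

Lemma norm_hgtn k x : `|hgtn k x| <= 3 ^+ n * 2 * `|x|.
Proof.
have t0 : (0 : R) <= 3 ^+ n by rewrite exprn_ge0.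
rewrite /hgtn normrM ger0_norm// -mulrA ler_wpM2l//.
have s33 := sqrt3_sqr R; have s0 : 0 <= (Num.sqrt 3 : R) by exact: sqrtr_ge0.
have c (i : 'I_2) : `|x i 0| <= `|x|.
  rewrite {2}/Num.norm /= mx_normrE.
  by apply: (le_trans _ (le_bigmax _ _ (i, 0))).
have := c 0; have := c 1; rewrite !ler_norml => /andP[? ?] /andP[? ?].
have s2 : (Num.sqrt 3 : R) <= 2 by nra.
by case: k; rewrite /hgt; apply/andP; split; nra.
Qed.

Lemma norm_le_hgtn x (M : R) : (forall k, `|hgtn k x| <= M) -> `|x| <= 2 * M.
Proof.
move=> HM; have t1 : (1 : R) <= 3 ^+ n by rewrite exprn_ege1// ler1n.
have hM k : `|hgt k x| <= M.
  apply: le_trans (HM k); rewrite normrM ger0_norm ?ler_peMl//.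
have M0 : 0 <= M by apply: le_trans (hM D0).
have s33 := sqrt3_sqr R; have s0 : 0 <= (Num.sqrt 3 : R) by exact: sqrtr_ge0.
have s2 : (Num.sqrt 3 : R) <= 2 by nra.
have -> : x = of_hgt (fun k => hgt k x).
  by apply: hgt_inj => k; rewrite hgt_of_hgt// hgt_sum.
rewrite /Num.norm /= mx_normrE; apply/bigmax_leP; split; first by lra.
move=> [i j] _ /=.
rewrite [j]ord1 /of_hgt; move: (hM D0) (hM D2) => {hM HM}.
move: (hgt D0 x) (hgt D2 x) => u v; rewrite !ler_norml => /andP[? ?] /andP[? ?].
have p1 : 0 <= (Num.sqrt 3 : R) * (M - u) by rewrite mulr_ge0// subr_ge0.
have p2 : 0 <= (Num.sqrt 3 : R) * (M + u) by rewrite mulr_ge0//; lra.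
have p3 : 0 <= (2 - (Num.sqrt 3 : R)) * M by rewrite mulr_ge0// subr_ge0.
case: i => -[|[|//]] i2; rewrite mxE /= ?ler_norml; apply/andP; split; lra.
Qed.

Lemma outside_unbounded a : is_tile a -> ~~ inside n a ->
  ~ bounded_set (connected_component (~` curve (KS R n)) (centroid a)).
Proof.
move=> ta oa [M [_ bM]].
have {}bM x : connected_component (~` curve (KS R n)) (centroid a) x ->
    `|x| <= M + 1 by apply: bM; rewrite ltrDl.
pose N := (Num.trunc (3 ^+ n * 2 * (M + 1))).+2.
have [b rb Nb] := escape N ta oa.
have /bM bx := reach_component R ta rb.
have [ob tb] := outside_reach oa ta rb.
have : `|hgtn D2 (centroid b)| <= 3 ^+ n * 2 * (M + 1).
  by apply: le_trans (norm_hgtn _ _) _; rewrite ler_wpM2l// mulr_ge0// exprn_ge0.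
have M1 : 0 <= 3 ^+ n * 2 * (M + 1).
  by rewrite mulr_ge0 ?mulr_ge0 ?exprn_ge0// (le_trans _ bx).
have /andP[_ tN] := truncn_itv M1 => Hb.
have e : (b D2)%:~R = hgtn D2 (centroid b) + (tile_sum b)%:~R / 3.
  by rewrite hgtn_centroid subrK.
have nb : `|(b D2)%:~R : R| <= `|hgtn D2 (centroid b)| + 1.
  rewrite e; apply: le_trans (ler_normD _ _) _; rewrite lerD2l ler_norml.
  by move: tb => /orP[] /eqP ->; rewrite ?intrN; apply/andP; split; lra.
move: Nb; rewrite -(ltr_int R) intr_norm /N -addn2 PoszD intrD => Nb.
rewrite -(addn1 (Num.trunc _)) natrD in tN.
by move: Nb tN nb Hb; rewrite -!pmulrn; lra.
Qed.

Definition inner : set plane :=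
  [set x | exists a, [/\ is_tile a, inside n a & cell a x]].

(** Near [y] there are only cells that contain [y]: the tiling is locally
    finite. *)
Lemma local_cells y : exists W : set plane, open_nbhs y W /\
  forall x b, W x -> cell b x -> cell b y.
Proof.
(* [I k] contains no integer, except [hgtn k y] if it is one. *)
pose I k : set R := [set z | (Num.ceil (hgtn k y) - 1)%:~R < z] `&`
  [set z | z < (Num.floor (hgtn k y) + 1)%:~R].
exists (hgtn D0 @^-1` I D0 `&` (hgtn D1 @^-1` I D1 `&` hgtn D2 @^-1` I D2)).
have oI k : open (hgtn k @^-1` I k).
  apply: open_comp; first by move=> ? _; exact: hgtn_continuous.
  by apply: openI; [exact: open_gt|exact: open_lt].
have Iy k : I k (hgtn k y).
  split => /=; first by have /andP[-> _] := ceil_itv (hgtn k y).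
  by have /andP[_ ->] := floor_itv (hgtn k y).
split; first by split; [do 2!apply: openI => //|do !split; apply Iy].
move=> x b [x0 [x1 x2]] bx k.
have [/= c1 c2] : I k (hgtn k x) by case: (k).
have /andP[b1 b2] := bx k; apply/andP; split.
  by rewrite -floor_ge_int -ltzD1 -(ltr_int R); exact: le_lt_trans c2.
have e : (b k + 1)%:~R = (b k)%:~R + 1 :> R by rewrite intrD.
rewrite -e -ceil_le_int -ltzD1 -ltrBlDr -(ltr_int R) e.
exact: lt_le_trans b2.
Qed.

Lemma inner_closed : closed inner.
Proof.
rewrite -openC openE => y ny; have [W [oW Wcell]] := local_cells y.
apply: (filterS _ (open_nbhs_nbhs oW)) => x Wx [a [ta ia ax]].
by apply: ny; exists a; split=> //; exact: Wcell ax.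
Qed.

(** Off the curve, all the cells around a point are inside as soon as one is.
    So [inner] is open and closed there, and contains whole components. *)
Lemma inner_component x : inner x -> ~ curve (KS R n) x ->
  connected_component (~` curve (KS R n)) x `<=` inner.
Proof.
move=> ix nx; set C := connected_component _ x.
suff : C `&` inner = C by move=> <- y [].
have Cx : C x by exact: connected_component_refl.
have cC : connected C by exact: component_connected.
apply: cC; first by exists x.
- exists (inner°); first exact: open_interior.
  apply/seteqP; split=> y [Cy iy]; split=> //; last exact: interior_subset.
  have [W [oW Wcell]] := local_cells y.
  have [a [ta ia ay]] := iy.
  apply: (filterS _ (open_nbhs_nbhs oW)) => z /Wcell Wz.
  have [b [tb bz]] := cell_cover n z.
  exists b; split=> //.
  apply: (@curve_cells R n y) ia => //; last exact: Wz.
  exact: (connected_component_sub Cy).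
- by exists inner => //; exact: inner_closed.
Qed.

Lemma curve_inner x : curve (KS R n) x -> inner x.
Proof. by move=> /curveP[a [k [ta ia _ ax _]]]; exists a. Qed.

Lemma inner_bounded : bounded_set inner.
Proof.
have [N bN] := inside_bounded n.
exists (2 * (N%:R + 1)); split; first exact: num_real.
move=> M NM x [a [ta ia ax]]; apply: le_trans (ltW NM).
apply: norm_le_hgtn => k.
have := bN a ta ia k; rewrite -(ler_int R) intr_norm -pmulrn ler_norml => /andP[? ?].
by have /andP[? ?] := ax k; rewrite ler_norml; apply/andP; split; lra.
Qed.

Lemma region_KS : region (KS R n) = inner.
Proof.
apply/seteqP; split=> x.
  case=> [/curve_inner//|[nx bx]].
  have [a [ta ax]] := cell_cover n x.
  exists a; split=> //; apply: contrapT => /negP oa.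
  apply: (outside_unbounded ta oa).
  by rewrite -(same_connected_component (centroid_component ta ax nx)).
move=> ix; have [cx|nx] := pselect (curve (KS R n) x); first by left.
right; split=> //.
have [M [Mr bM]] := inner_bounded.
exists M; split=> // K MK y /(inner_component ix nx) iy; exact: (bM K MK).
Qed.

End Region.

(** * Products with a discrete space *)

Section Copies.
Variables (X : topologicalType) (A : set X) (T : choiceType).
Local Notation prod := (A * discrete_topology T)%type.

(** A product with a discrete space is a disjoint union of slices. *)
Lemma slice_closed (K : set prod) (t : T) : closed K ->
  exists2 C, closed C & forall x : A, K (x, t) <-> C (set_val x).
Proof.
move=> cK; pose f (x : A) : prod := (x, t).
have cf : continuous f.
  move=> x U [[P Q] /= [nP nQ] PQU].
  apply: (@filterS _ (nbhs x) _ P) => // y Py.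
  by apply: PQU; split=> //=; exact: nbhs_singleton nQ.
have : open (f @^-1` (~` K)).
  by apply: open_comp => //; exact: closed_openC.
move=> [V oV VK]; exists (~` V); first exact: open_closedC.
move=> x; have e : (set_val @^-1` V) x = (~` K) (f x) by rewrite VK.
split=> [Kx Vx|nV]; first by have : (~` K) (f x) by rewrite -e.
by apply: contrapT => nK; apply: nV; move: nK; rewrite -[~ _]/((~` K) (f x)) -e.
Qed.

Lemma closed_slices (K : set prod) :
  (forall t : T, exists2 C, closed C &
     forall x : A, K (x, t) <-> C (set_val x)) -> closed K.
Proof.
move=> KC; rewrite -openC openE => -[x t] nK.
have [C cC CK] := KC t.
exists (set_val @^-1` (~` C), [set t]) => /=.
  split.
    apply: open_nbhs_nbhs; split; last by move=> /CK.
    by exists (~` C) => //; exact: closed_openC.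
  by apply: open_nbhs_nbhs; split=> //; exact: discrete_open.
by move=> [x' t'] /= [nC ->] /CK.
Qed.

End Copies.

(** * Charts of the cells *)

Definition dirz (z : int) : dir :=
  if (z %% 3)%Z == 0 then D0 else if (z %% 3)%Z == 1 then D1 else D2.

(** The bijection from the directions of the edges of [a] to the edges of the
    unit triangle that folding along the lines of the tiling induces. The value
    at [D0] is an affine form modulo 3 of the tile: this comes from colouring
    the nodes of the lattice with three colours, distinct on each tile. *)
Definition label (a : tile) : dih :=
  (tile_sum a != -1, dirz (a D1 - a D2 + 1)).

Lemma dirzP z : [\/ (z %% 3)%Z = 0 /\ dirz z = D0, (z %% 3)%Z = 1 /\ dirz z = D1
  | (z %% 3)%Z = 2 /\ dirz z = D2].
Proof.
rewrite /dirz; have : [|| (z %% 3)%Z == 0, (z %% 3)%Z == 1 | (z %% 3)%Z == 2] by lia.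
by case/or3P => /eqP ->; [apply: Or31|apply: Or32|apply: Or33].
Qed.

Lemma dirzD1 z : dirz (z + 1) = next (dirz z).
Proof.
by case: (dirzP z) => -[e ->]; case: (dirzP (z + 1)) => -[e' ->] //; lia.
Qed.

Lemma label_nbr k a : is_tile a -> label (nbr k a) = muld (label a) (refl k).
Proof.
move=> ta; rewrite /label /muld /act /=.
have hn : (tile_sum (nbr k a) != -1) = ~~ (tile_sum a != -1).
  by move: ta; case: k; rewrite /is_tile /nbr /tile_sum /=; lia.
rewrite hn addbT; congr pair.
pose z := a D1 - a D2 + 1; rewrite -/z.
have [[ha ->]|[ha ->]] : (tile_sum a = -1 /\ nbr k a D1 - nbr k a D2 + 1 = 
    z + match k with D0 => 0 | D1 => -1 | D2 => 1 end) \/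
  (tile_sum a = -2 /\ nbr k a D1 - nbr k a D2 + 1 = 
    z - match k with D0 => 0 | D1 => -1 | D2 => 1 end).
- by move: ta; rewrite /z; case: k {hn}; rewrite /is_tile /nbr /=; lia.
- rewrite ha /=; have := dirzD1 (z - 1); rewrite subrK.
  by case: k {hn} => /=; rewrite ?addr0 ?dirzD1 => ->; case: (dirz _).
- rewrite ha /=; have := dirzD1 (z - 1); rewrite subrK.
  by case: k {hn} => /=; rewrite ?subr0 ?opprK ?dirzD1 => ->; case: (dirz _).
Qed.

Lemma act_muld r q k : act (muld r q) k = act r (act q k).
Proof. by case: r q k => [[] []] [[] []] []. Qed.

Lemma invd_actK r k : act (invd r) (act r k) = k.
Proof. by case: r k => [[] []] []. Qed.

Lemma act_invdK r k : act r (act (invd r) k) = k.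
Proof. by case: r k => [[] []] []. Qed.

Lemma act_refl k : act (refl k) k = k. Proof. by case: k. Qed.

Section Charts.
Variable R : realType.
Local Notation plane := 'cV[R]_2.
Implicit Types (a b : tile) (k i e f : dir) (x y : plane).

(** The barycentric coordinate of the unit triangle that vanishes on the edge
    [e]. *)
Definition bary e y : R := hgt e y - (seed e)%:~R.

Definition triangle : set plane := [set y | forall e, 0 <= bary e y].

Definition tri_edge e : set plane := [set y | bary e y = 0].

Lemma bary_sum y : bary D0 y + bary D1 y + bary D2 y = 1.
Proof. by have := hgt_sum y; rewrite /bary /seed /=; lra. Qed.

Lemma bary_act r y : bary (act r D0) y + bary (act r D1) y + bary (act r D2) y = 1.
Proof. by have := bary_sum y; case: r => [[] []] /=; lra. Qed.

Lemma bary_inj y z : (forall e, bary e y = bary e z) -> y = z.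
Proof. move=> e; apply: hgt_inj => k; apply: (@addIr _ (- (seed k)%:~R)); exact: e. Qed.

Lemma affine_continuous (T : topologicalType) (f : T -> R) (u v : R) :
  continuous f -> continuous (fun t => u + v * f t).
Proof.
move=> cf t; have c1 := @cvgMl_tmp _ _ _ _ _ v _ (cf t).
exact: (cvgD (cvg_cst u) (c1 _)).
Qed.

Lemma bary_continuous e : continuous (bary e).
Proof.
rewrite (_ : bary e = fun y => - (seed e)%:~R + 1 * hgt e y).
  exact/affine_continuous/hgt_continuous.
by apply/funext => y; rewrite /bary; ring.
Qed.

Definition of_bary (f : dir -> R) : plane := of_hgt (fun e => f e + (seed e)%:~R).

Lemma bary_of_bary (f : dir -> R) e : f D0 + f D1 + f D2 = 1 ->
  bary e (of_bary f) = f e.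
Proof. by move=> f1; rewrite /bary hgt_of_hgt ?addrK//= /seed /=; lra. Qed.

Variable n : nat.
Local Notation hgtn := (@hgtn R n).
Local Notation cell := (@cell R n).

(** The heights of the point of the cell [a] with the barycentric coordinates
    of [y]; edges are matched by the label. *)
Definition place a y k : R :=
  if tile_sum a == -1 then (a k)%:~R + bary (act (label a) k) y
  else (a k)%:~R + 1 - bary (act (label a) k) y.

Definition chart a y : plane := of_hgtn n (place a y).

Definition unplace a x e : R :=
  let k := act (invd (label a)) e in
  if tile_sum a == -1 then hgtn k x - (a k)%:~R else (a k)%:~R + 1 - hgtn k x.

Definition unchart a x : plane := of_bary (unplace a x).

Lemma hgtn_chart k a y : is_tile a -> hgtn k (chart a y) = place a y k.
Proof.
move=> ta; apply: hgtn_of_hgtn; have := bary_act (label a) y.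
rewrite /place; move: ta => /orP[] /eqP e; rewrite e /=;
  move: e => /(congr1 (fun z : int => z%:~R : R));
  rewrite /tile_sum !intrD ?intrN; lra.
Qed.

Lemma bary_unchart e a x : is_tile a -> bary e (unchart a x) = unplace a x e.
Proof.
move=> ta; apply: bary_of_bary; have := hgtn_sum n x.
rewrite /unplace; move: ta => /orP[] /eqP eh; rewrite eh /=;
  move: eh => /(congr1 (fun z : int => z%:~R : R));
  rewrite /tile_sum !intrD ?intrN; case: (label a) => [[] []] /=; lra.
Qed.

Lemma chartK a : is_tile a -> cancel (chart a) (unchart a).
Proof.
move=> ta y; apply: bary_inj => e; rewrite bary_unchart// /unplace hgtn_chart//.
by rewrite /place act_invdK; case: (tile_sum a == -1); ring.
Qed.

Lemma unchartK a : is_tile a -> cancel (unchart a) (chart a).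
Proof.
move=> ta x; apply: (@hgtn_inj R n) => k; rewrite hgtn_chart// /place bary_unchart//.
by rewrite /unplace invd_actK; case: (tile_sum a == -1); ring.
Qed.

Lemma triangle_le1 y e : triangle y -> bary e y <= 1.
Proof.
move=> Dy; have := bary_sum y; have := Dy D0; have := Dy D1; have := Dy D2.
by case: e; lra.
Qed.

Lemma chart_cell a y : is_tile a -> triangle y -> cell a (chart a y).
Proof.
move=> ta Dy k; rewrite hgtn_chart// /place.
have := Dy (act (label a) k); have := triangle_le1 (act (label a) k) Dy.
by case: (tile_sum a == -1) => b1 b0; apply/andP; split; lra.
Qed.

Lemma unchart_triangle a x : is_tile a -> cell a x -> triangle (unchart a x).
Proof.
move=> ta ax e; rewrite bary_unchart// /unplace.
have /andP[] := ax (act (invd (label a)) e).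
by case: (tile_sum a == -1) => *; lra.
Qed.

Lemma chart_continuous a : continuous (chart a).
Proof.
apply: (@of_hgt_continuous R _ (fun y k => place a y k / 3 ^+ n)) => k.
pose u : R := if tile_sum a == -1 then (a k)%:~R else (a k)%:~R + 1.
pose v : R := if tile_sum a == -1 then 1 else - 1.
rewrite (_ : (fun y => _) =
    fun y => u / 3 ^+ n + v / 3 ^+ n * bary (act (label a) k) y).
  exact/affine_continuous/bary_continuous.
by apply/funext => y; rewrite /place /u /v; case: (tile_sum a == -1); ring.
Qed.

Lemma unchart_continuous a : continuous (unchart a).
Proof.
apply: (@of_hgt_continuous R _ (fun x e => unplace a x e + (seed e)%:~R)) => e.
pose k := act (invd (label a)) e.
pose u : R := if tile_sum a == -1 then - (a k)%:~R else (a k)%:~R + 1.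
pose v : R := if tile_sum a == -1 then 1 else - 1.
rewrite (_ : (fun x => _) = fun x => (u + (seed e)%:~R) + v * hgtn k x).
  exact/affine_continuous/hgtn_continuous.
by apply/funext => y; rewrite /unplace /u /v -/k; case: (tile_sum a == -1); ring.
Qed.

(** The labels of two adjacent tiles differ by the reflection that fixes the
    common edge, so both charts agree on it. *)
Lemma chart_nbr a k y : is_tile a -> tri_edge (act (label a) k) y ->
  chart (nbr k a) y = chart a y.
Proof.
move=> ta ey; apply: (@hgtn_inj R n) => i; have tb := tile_nbr k ta.
rewrite !hgtn_chart// /place label_nbr// act_muld.
have bs := bary_act (label a) y; rewrite /tri_edge /= in ey.
have other j : j <> k ->
    bary (act (label a) (act (refl k) j)) y = 1 - bary (act (label a) j) y.
  by case: (k) ey; case: j => // ey _; move: bs ey => /=; lra.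
have [[ha bk]|[ha bk]] := nbr_on k ta.
  have hb : tile_sum (nbr k a) == -2.
    by move: ta ha; case: (k); rewrite /is_tile /nbr /tile_sum /=; lia.
  rewrite ha (eqP hb) /=; case: (dir_eq_dec i k) => [->|ik].
    by rewrite bk act_refl ey intrB; ring.
  by rewrite nbr_off ?other//; ring.
have hb : tile_sum (nbr k a) == -1.
  by move: ta ha; case: (k); rewrite /is_tile /nbr /tile_sum /=; lia.
rewrite ha (eqP hb) /=; case: (dir_eq_dec i k) => [->|ik].
  by rewrite bk act_refl ey intrD; ring.
by rewrite nbr_off ?other//; ring.
Qed.

Lemma wall_bary a k x : is_tile a -> cell a x -> cell (nbr k a) x ->
  tri_edge (act (label a) k) (unchart a x).
Proof.
move=> ta ax bx; rewrite /tri_edge /= bary_unchart// /unplace invd_actK.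
have := ax k; have := bx k.
have [[-> ->]|[-> ->]] := nbr_on k ta; rewrite /= ?(intrD, intrN);
  move=> /andP[? ?] /andP[? ?]; lra.
Qed.

(** By [cell_linked] it suffices to compare adjacent cells, and adjacent charts
    agree. *)
Lemma chart_same a b y z : is_tile a -> is_tile b -> triangle y -> triangle z ->
  chart a y = chart b z -> y = z.
Proof.
move=> ta tb Dy Dz e.
rewrite -(chartK tb z) -e.
apply/esym; apply: (@cell_linked R n (chart a y)
  (fun c => unchart c (chart a y) = y) _ a b ta tb) => //.
- move=> c k tc cx dx ec.
  have := chart_nbr tc (wall_bary tc cx dx); rewrite unchartK// ec => <-.
  by rewrite chartK//; exact: tile_nbr.
- exact: chart_cell.
- by rewrite e; exact: chart_cell.
- exact: chartK.
Qed.

Lemma chart_edge a k y : is_tile a -> triangle y ->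
  tri_edge (act (label a) k) y -> cell (nbr k a) (chart a y).
Proof.
move=> ta Dy ey; rewrite -(chart_nbr ta ey).
by apply: chart_cell => //; exact: tile_nbr.
Qed.

(** Away from the vertices only two cells may meet. *)
Lemma chart_only_edge a b e y : is_tile a -> is_tile b ->
  only_edge triangle tri_edge e y -> cell b (chart a y) ->
  let k := act (invd (label a)) e in b = a \/ b = nbr k a /\ tri_edge e y.
Proof.
move=> ta tb [Dy cy] bx k.
have pos f : f <> e -> 0 < bary f y.
  move=> fe; rewrite lt_neqAle Dy andbT; apply/negP => /eqP f0.
  by apply: fe; apply: cy; rewrite /tri_edge /= -f0.
have lt1 f : f <> e -> bary f y < 1.
  move=> fe; have := bary_sum y; have := Dy e; have [g [ge gf]] :
    exists g, g <> e /\ g <> f.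
    by case: (e) fe; case: (f) => // _;
      [exists D2|exists D1|exists D2|exists D0|exists D1|exists D0].
  have := pos _ ge; have := pos _ fe.
  by case: (e) fe ge; case: (f) gf; case: (g) => //=; lra.
have strict i : i <> k -> (a i)%:~R < hgtn i (chart a y) < (a i)%:~R + 1.
  move=> ik; rewrite hgtn_chart// /place.
  have fe : act (label a) i <> e.
    by move=> fe; apply: ik; rewrite /k -fe invd_actK.
  have := pos _ fe; have := lt1 _ fe.
  by case: (tile_sum a == -1) => ? ?; apply/andP; split; lra.
have [->|bE] := two_cells ta tb bx strict; [by left|right; split=> //].
have := wall_bary (k := k) ta (chart_cell ta Dy).
by rewrite -bE => /(_ bx); rewrite chartK// /k act_invdK.
Qed.

Lemma integer_bary a k y (z : int) : is_tile a -> triangle y ->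
  ~ cornered tri_edge y -> hgtn k (chart a y) = z%:~R ->
  tri_edge (act (label a) k) y.
Proof.
move=> ta Dy ncy; rewrite hgtn_chart// /place.
set e := act (label a) k => zE.
have [m mE] : exists m : int, bary e y = m%:~R.
  move: zE; case: (tile_sum a == -1) => zE; [exists (z - a k)|exists (a k + 1 - z)];
    rewrite !intrD ?intrN; lra.
have b0 := Dy e; have b1 := triangle_le1 e Dy.
have [m0|m1] : m = 0 \/ m = 1.
  by move: b0 b1; rewrite mE (ler_int R 0) (ler_int R _ 1); lia.
  by rewrite /tri_edge /= mE m0.
exfalso; apply: ncy; exists (next e), (next (next e)).
have := bary_sum y; have := Dy (next e); have := Dy (next (next e)).
rewrite m1 in mE; rewrite /tri_edge /= ; move: mE.
by case: (e) => /= *; split=> //; lra.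
Qed.

Lemma closed_ge0 (f : plane -> R) : continuous f -> closed [set y | 0 <= f y].
Proof.
move=> cf; apply: (preimage_closed (f := f) (D := [set z : R | 0 <= z])).
  by move=> ? _; exact: cf.
exact: closed_ge.
Qed.

Lemma triangle_closed : closed triangle.
Proof.
rewrite (_ : triangle = \bigcap_e [set y | 0 <= bary e y]).
  by apply: closed_bigI => e _; apply: closed_ge0; exact: bary_continuous.
by apply/seteqP; split=> [y Dy e _|y Dy e]; exact: Dy.
Qed.

Lemma triangle_edge_closed e : closed (triangle `&` tri_edge e).
Proof.
rewrite (_ : _ `&` _ = triangle `&` [set y | 0 <= 0 + (-1) * bary e y]).
  apply: closedI; first exact: triangle_closed.
  by apply: closed_ge0; apply: affine_continuous; exact: bary_continuous.
apply/seteqP; split=> y [Dy]; rewrite /tri_edge /= => ey; split=> //=.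
  by rewrite ey mulr0 addr0.
by have := Dy e; lra.
Qed.

Lemma triangle_corners : finite_set (triangle `&` cornered tri_edge).
Proof.
apply: (@sub_finite_set _ _ [set of_bary (fun i => (same k i)%:R) | k in [set: dir]]);
  last exact/finite_image/finite_dir.
move=> y [Dy [e [f [ef]]]]; rewrite /tri_edge /= => ey fy.
have [g [ge gf]] : exists g, g <> e /\ g <> f.
  by case: (e) ef; case: (f) => // _;
    [exists D2|exists D1|exists D2|exists D0|exists D1|exists D0].
exists g => //; apply: bary_inj => i; rewrite bary_of_bary; last first.
  by case: (g) => /=; ring.
have := bary_sum y; move: ey fy ef ge gf.
by case: (e); case: (f) => //; case: (g) => //; case: i => //= *; lra.
Qed.

End Charts.

(** * The surface of a Koch polygon is tiled *)

Section Surface.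
Variable R : realType.
Variable n : nat.
Local Notation plane := 'cV[R]_2.
Local Notation P := (KS R n).
Local Notation hgtn := (@hgtn R n).
Local Notation cell := (@cell R n).
Local Notation chart := (@chart R n).
Local Notation unchart := (@unchart R n).
Implicit Types (a b : tile) (k e : dir) (r q : dih) (x y : plane).

Lemma region_inhabited : exists x, x \in region P.
Proof.
have [a [ta ia _]] := boundary_direction n D0.
exists (centroid R n a); apply/mem_set; rewrite region_KS; exists a; split=> //.
exact/open_cellW/centroid_cell.
Qed.

Definition base_pt : region P :=
  let: exist x xP := cid region_inhabited in exist _ x xP.

Lemma rho_dihedral r : rho R r \in dihedral P.
Proof. by apply/mem_set; rewrite dihedral_KS; exists r. Qed.

Definition dih_elt r : dihedral P := exist _ (rho R r) (rho_dihedral r).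

Definition copy x r : copies P := (insubd base_pt x, dih_elt r).

Lemma copy_ptE x r : region P x -> copy_pt (copy x r) = x.
Proof. by move=> Px; rewrite /copy_pt /= set_valE insubdK//; exact/mem_set. Qed.

Lemma copy_mxE x r : copy_mx (copy x r) = rho R r.
Proof. by []. Qed.

Lemma dih_eltP (m : dihedral P) : exists r, m = dih_elt r.
Proof.
have [r _ rm] : range (rho R) (val m).
  by move: (set_mem (valP m)); move: (val m) => M; rewrite dihedral_KS.
by exists r; exact: val_inj.
Qed.

Lemma copyP (u : copies P) : exists x r, region P x /\ u = copy x r.
Proof.
case: u => v m; have [r ->] := dih_eltP m.
exists (val v), r; split; first exact/set_mem/(valP v).
by rewrite /copy valKd.
Qed.

Definition proj (u : copies P) : flat_surface P :=
  (\pi_({eq_quot (glue_equiv_rel P)}) u)%qT.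

Lemma projP (z : flat_surface P) : exists u, z = proj u.
Proof. by exists (repr (z : {eq_quot (glue_equiv_rel P)}))%qT; rewrite /proj reprK. Qed.

Lemma proj_eq u v :
  proj u = proj v <-> clos_refl_sym_trans _ (@glued R P) u v.
Proof.
split; first by move/eqmodP/asboolP.
by move=> uv; apply/eqmodP/asboolP.
Qed.

Lemma closed_proj (V : set (flat_surface P)) :
  closed V <-> closed (proj @^-1` V).
Proof. by rewrite -openC -[X in _ <-> X]openC. Qed.

Lemma closed_slicesP (V : set (flat_surface P)) : closed V <->
  forall r, exists2 C, closed C &
    forall x, region P x -> V (proj (copy x r)) <-> C x.
Proof.
rewrite closed_proj; split=> [cV r|cV].
  have [C cC CV] := slice_closed (dih_elt r) cV.
  exists C => // x Px; have := CV (insubd base_pt x).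
  by rewrite set_valE insubdK//; exact/mem_set.
apply: closed_slices => m; have [r ->] := dih_eltP m.
have [C cC CV] := cV r; exists C => // v.
by rewrite -(CV (val v)) /copy ?valKd//; exact/set_mem/(valP v).
Qed.

(** What gluing implies: at a point that lies on at most one line of the
    tiling, only the reflection in a side through the point can relate two
    copies. At the nodes of the lattice nothing is recorded about the
    group elements. *)
Definition related (u v : copies P) : Prop :=
  copy_pt u = copy_pt v /\
  ((forall k l (i j : int), hgtn k (copy_pt u) = i%:~R -> hgtn l (copy_pt u) = j%:~R ->
      k = l) ->
   copy_mx u = copy_mx v \/
   exists a k, [/\ is_tile a, inside n a, ~~ inside n (nbr k a),
     cell a (copy_pt u) /\ cell (nbr k a) (copy_pt u) &
     copy_mx v = copy_mx u * rho R (refl k)]).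

Lemma wall_integer a k x : is_tile a -> cell a x -> cell (nbr k a) x ->
  exists i : int, hgtn k x = i%:~R.
Proof.
move=> ta ax bx; have := ax k; have := bx k.
have [[_ ->]|[_ ->]] := nbr_on k ta; rewrite !intrD ?intrN => /andP[? ?] /andP[? ?];
  [exists (a k)|exists (a k + 1)]; rewrite ?intrD; lra.
Qed.

Lemma refl_refl (M : 'M[R]_2) k : M * rho R (refl k) * rho R (refl k) = M.
Proof. by rewrite -mulrA -rhoM reflK rho1 mulr1. Qed.

(** Two sides through a point that is not a node lie on the same line, so
    crossing twice comes back to the same copy. *)
Lemma glued_related u v :
  clos_refl_sym_trans _ (@glued R P) u v -> related u v.
Proof.
elim=> {u v} [u v|u|u v _ [uv ruv]|u v w _ [uv ruv] _ [vw rvw]].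
- move=> [uv glue_uv]; split=> // gen.
  have munit : copy_mx u \is a GRing.unit.
    by have [x [r [_ ->]]] := copyP u; exact: rho_unit.
  case: glue_uv => [->|[[A B]] /sides_KS[_ [_ [[a [k [ta ia oa -> ->]]] -> ->]]]|
    [[A B] [_ [/sides_KS[A' [B' [AB _ BE]]] _ /= Bu _ _]]]].
  + by left.
  + rewrite boundary_refl// => -[/(@edgeP R n _ _ _ ta)[ax bx] mE].
    right; exists a, k; split=> //.
    by rewrite -mE mulVKr.
  + exfalso; have [_ zB] := tile_sum_boundary AB.
    suff : D0 = D1 by [].
    by apply: (gen _ _ (B' D0) (B' D1)); rewrite -Bu BE hgtn_node.
- by split=> // _; left.
- split=> [//|]; rewrite -uv => /ruv[->|[a [k [ta ia oa ax mE]]]]; first by left.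
  by right; exists a, k; split=> //; rewrite mE refl_refl.
split=> [|gen]; first by rewrite uv.
case: (ruv gen) => [->|[a [k [ta ia oa ax mE]]]].
  by rewrite uv; apply: rvw; rewrite -uv.
rewrite -uv in rvw; case: (rvw gen) => [<-|[b [l [tb ib ob bx mE']]]].
  by right; exists a, k.
left; have [i Hi] := wall_integer ta ax.1 ax.2.
have [j Hj] := wall_integer tb bx.1 bx.2.
by rewrite mE' mE -(gen _ _ _ _ Hi Hj) refl_refl.
Qed.

Definition tile_index := (tile * dih)%type.

Definition inside_index : set tile_index :=
  [set i | is_tile i.1 /\ inside n i.1].

Definition surface_chart (i : tile_index) y : flat_surface P :=
  proj (copy (chart i.1 y) i.2).

(** Crossing the edge [e] of a tile of the surface: either the tile behind it
    is inside, or the edge is a side of the polygon and one passes to the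
    reflected copy. *)
Definition across e (i : tile_index) : tile_index :=
  let k := act (invd (label i.1)) e in
  if inside n (nbr k i.1) then (nbr k i.1, i.2) else (i.1, muld i.2 (refl k)).

Lemma chart_region a y : is_tile a -> inside n a -> @triangle R y ->
  region P (chart a y).
Proof.
by move=> ta ia Dy; rewrite region_KS; exists a; split=> //; exact: chart_cell.
Qed.

Lemma across_inside e i : inside_index i -> inside_index (across e i).
Proof.
by move=> [ti ii]; rewrite /across; case: ifP => //= ib; split=> //; exact: tile_nbr.
Qed.

Lemma acrossK e i : inside_index i -> across e (across e i) = i.
Proof.
case: i => a r [/= ta ia]; rewrite /across /=.
set k := act (invd (label a)) e.
have ke : act (label a) k = e by rewrite act_invdK.
have [ib|/negbTE ib] := boolP (inside n (nbr k a)); last first.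
  by rewrite /= -/k ib -muldA reflK muld1.
rewrite /=.
have -> : act (invd (label (nbr k a))) e = k.
  have eM : act (muld (label a) (refl k)) k = e by rewrite act_muld act_refl.
  by rewrite label_nbr// -[in LHS]eM invd_actK.
by rewrite nbrK// ia.
Qed.

Lemma across_glue e i y : inside_index i -> @triangle R y -> tri_edge e y ->
  surface_chart (across e i) y = surface_chart i y.
Proof.
case: i => a r [/= ta ia] Dy ey; rewrite /across /surface_chart /=.
set k := act (invd (label a)) e.
have ek : tri_edge (act (label a) k) y by rewrite act_invdK.
case: ifP => ib /=; first by rewrite chart_nbr.
have Px := chart_region ta ia Dy.
apply/esym/proj_eq/rst_step; split; first by rewrite !copy_ptE.
apply: Or32; exists (node R n (vertex (next k) a), node R n (vertex (next (next k)) a)).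
  apply/sides_KS; exists (vertex (next k) a), (vertex (next (next k)) a).
  by split=> //; exists a, k; rewrite ib.
rewrite boundary_refl// !copy_mxE copy_ptE//; split; last first.
  by rewrite rhoM mulKr// rho_unit.
by apply/(@edgeP R n _ _ _ ta); split; [exact: chart_cell|exact: chart_edge].
Qed.

Lemma surface_chart_related i j y z : surface_chart i y = surface_chart j z ->
  related (copy (chart i.1 y) i.2) (copy (chart j.1 z) j.2).
Proof. by move=> /proj_eq/glued_related. Qed.

Lemma surface_chart_same i j y z : inside_index i -> inside_index j -> @triangle R y ->
  triangle z -> surface_chart i y = surface_chart j z -> y = z.
Proof.
move=> iA jA Dy Dz e; have [] := surface_chart_related e.
case: iA => ti ii; case: jA => tj ij.
rewrite !copy_ptE; [|exact: chart_region..] => /chart_same + _.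
exact.
Qed.

(** Two cells at most contain the point, and if it lies on a side of the
    polygon then exactly one of them is inside. *)
Lemma surface_chart_inj i j y : inside_index i -> inside_index j -> @triangle R y ->
  ~ cornered (@tri_edge R) y -> surface_chart i y = surface_chart j y ->
  i = j \/ exists e, tri_edge e y /\ j = across e i.
Proof.
move=> iA jA Dy ncy eq_tau; have := surface_chart_related eq_tau.
case: i iA eq_tau => a r [/= ta ia]; case: j jA => b q [/= tb ib] _.
have Pa := chart_region ta ia Dy; have Pb := chart_region tb ib Dy.
have [e cy] := only_edge_exists Dy ncy.
rewrite /related !copy_mxE !copy_ptE// => -[ab rel].
pose k := act (invd (label a)) e.
have edge_k l (z : int) : hgtn l (chart a y) = z%:~R -> l = k /\ tri_edge e y.
  move=> /(integer_bary ta Dy ncy) el; have le := cy.2 _ el.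
  by rewrite /k -le invd_actK le in el *.
have {}rel : r = q \/ exists c l, [/\ is_tile c, inside n c, ~~ inside n (nbr l c),
    cell c (chart a y) /\ cell (nbr l c) (chart a y) & q = muld r (refl l)].
  have [l l' z z' /edge_k[-> _] /edge_k[-> _] //|/rho_inj ->|] := rel; first by left.
  move=> [c [l [tc ic oc cx qE]]]; right; exists c, l; split=> //.
  by apply: (@rho_inj R); rewrite qE rhoM.
have bx : cell b (chart a y) by rewrite ab; exact: chart_cell.
(* The point lies on one line of the tiling only, so a side of the polygon
   through it is the edge [k] of [a]. *)
have wall c l : is_tile c -> inside n c -> ~~ inside n (nbr l c) ->
    cell c (chart a y) -> cell (nbr l c) (chart a y) ->
    [/\ l = k, ~~ inside n (nbr k a) & tri_edge e y].
  move=> tc ic oc cx dx; have [z /edge_k[lk ey]] := wall_integer tc cx dx.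
  subst l; split=> //.
  have [ca|[ca _]] := chart_only_edge ta tc cy cx; first by rewrite -ca.
  by move: oc; rewrite ca -/k nbrK// ia.
case: rel => [<-|[c [l [tc ic oc [cx dx] ->]]]].
  have [->|[bE ey]] := chart_only_edge ta tb cy bx; first by left.
  by right; exists e; split=> //; rewrite /across /= -/k -bE ib.
have [lk ok ey] := wall c l tc ic oc cx dx; subst l.
right; exists e; split=> //; rewrite /across /= -/k (negbTE ok).
have [->//|[bE _]] := chart_only_edge ta tb cy bx.
by move: ok; rewrite -/k in bE; rewrite -bE ib.
Qed.

Lemma surface_chart_cover z : exists i y,
  [/\ inside_index i, @triangle R y & z = surface_chart i y].
Proof.
have [u ->] := projP z; have [x [r [Px ->]]] := copyP u.
have [a [ta ia ax]] : inner n x by rewrite -region_KS.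
exists (a, r), (unchart a x); split=> //; first exact: unchart_triangle.
by rewrite /surface_chart unchartK.
Qed.

Lemma finite_inside : finite_set [set a | is_tile a /\ inside n a].
Proof.
have [N bN] := inside_bounded n.
pose I : set int := [set z | `|z| <= N%:Z].
have fI : finite_set I.
  apply: (@sub_finite_set _ _ [set ((i : nat)%:Z - N%:Z) | i in `I_(2 * N).+1]).
    move=> z /=; rewrite /I /= => zN; exists (absz (z + N%:Z)); rewrite /=; lia.
  exact/finite_image/finite_II.
pose triple (p : int * (int * int)) : tile :=
  fun k => match k with D0 => p.1 | D1 => p.2.1 | D2 => p.2.2 end.
apply: (@sub_finite_set _ _ (triple @` (I `*` (I `*` I)))); last first.
  by apply: finite_image; do 2!apply: finite_setX => //.
move=> a [ta ia]; exists (a D0, (a D1, a D2)); last by apply/funext; case.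
by split; [|split]; rewrite /I /=; exact: bN.
Qed.

Lemma finite_inside_index : finite_set inside_index.
Proof.
apply: (@sub_finite_set _ _ ([set a | is_tile a /\ inside n a] `*` [set: dih])).
  by move=> [a r] [].
by apply: finite_setX; [exact: finite_inside|exact: finite_dih].
Qed.

Lemma closed_finite_union (T : topologicalType) (I : Type) (A : set I)
    (F : I -> set T) :
  finite_set A -> (forall i, A i -> closed (F i)) ->
  closed (\bigcup_(i in A) F i).
Proof.
move=> fA cF; exact: (@closed_bigcup T {classic I} A F).
Qed.

(** The preimage of [V] in each copy of the region is a finite union of images
    of closed subsets of the triangle. *)
Lemma surface_chart_closed (V : set (flat_surface P)) :
  closed V <-> forall i, inside_index i ->
    closed (@triangle R `&` surface_chart i @^-1` V).
Proof.
rewrite closed_slicesP; split=> [cV [a r] [/= ta ia]|cV r].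
  have [C cC CV] := cV r.
  rewrite (_ : _ `&` _ = @triangle R `&` chart a @^-1` C).
    apply: closedI; last by apply: preimage_closed => // y _; exact: chart_continuous.
    exact: triangle_closed.
  apply/seteqP; split=> y [Dy]; rewrite /surface_chart /= => Vy; split=> //=.
    by apply/CV => //; exact: chart_region.
  by apply/CV => //; exact: chart_region.
exists (\bigcup_(a in [set a | is_tile a /\ inside n a])
    unchart a @^-1` (@triangle R `&` surface_chart (a, r) @^-1` V)).
  apply: closed_finite_union => [|a [ta ia]]; first exact: finite_inside.
  apply: preimage_closed; last exact: cV.
  by move=> x _; exact: unchart_continuous.
move=> x Px; split=> [Vx|[a [ta ia] [_]]]; last by rewrite /surface_chart /= unchartK.
have [a [ta ia ax]] : inner n x by rewrite -region_KS.
exists a => //; split; first exact: unchart_triangle.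
by rewrite /surface_chart /= unchartK.
Qed.

Lemma tiled_surface :
  tiled (@triangle R) (@tri_edge R) inside_index surface_chart across.
Proof.
split.
- exact: surface_chart_cover.
- exact: across_inside.
- exact: acrossK.
- exact: across_glue.
- exact: surface_chart_same.
- exact: surface_chart_inj.
- exact: surface_chart_closed.
Qed.

End Surface.

(** * The branched cover *)

(** Two distinct reflections generate the group, by words of length at most
    3. Hence all the tiles of the surface of the triangle meet at each vertex. *)
Lemma refl_generate e f r : e <> f -> exists w : seq bool,
  foldl (fun q (b : bool) => muld q (refl (if b then e else f))) r w = oned.
Proof.
move=> ef.
have : [\/ r = oned, muld r (refl e) = oned | muld r (refl f) = oned] \/
  [\/ muld (muld r (refl e)) (refl f) = oned,
      muld (muld r (refl f)) (refl e) = oned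
    | muld (muld (muld r (refl e)) (refl f)) (refl e) = oned].
  case: e f r ef => [] [] [[] []] // _;
  first [by left; first [by apply: Or31|by apply: Or32|by apply: Or33]
        |by right; first [by apply: Or31|by apply: Or32|by apply: Or33]].
by move=> [[]|[]] rw; [exists [::]|exists [:: true]|exists [:: false]
  |exists [:: true; false]|exists [:: false; true]|exists [:: true; false; true]].
Qed.

(** The reflection in an edge is conjugate, by the folding, to the reflection
    in the corresponding edge of the unit triangle. *)
Lemma refl_conj k r :
  muld (refl k) (invd r) = muld (invd r) (refl (act r k)).
Proof. by case: k; case: r => [[] []]. Qed.

Lemma refl_neq r k : muld r (refl k) <> r.
Proof. by move=> /(congr1 fst); case: r => [[] ?]. Qed.

Lemma across0 e r : across 0 e (seed, r) = (seed, muld r (refl e)).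
Proof. by case: e. Qed.

(** Crossing the edge [e] multiplies the colour by [refl e], whether or not the
    edge is a side of the polygon. *)
Lemma across_color n e a r : is_tile a ->
  muld (across n e (a, r)).2 (invd (label (across n e (a, r)).1)) =
  muld (muld r (invd (label a))) (refl e).
Proof.
move=> ta; rewrite /across /=; set k := act (invd (label a)) e.
have ke : act (label a) k = e by rewrite act_invdK.
rewrite -muldA -ke -refl_conj; case: ifP => _ /=; last by rewrite muldA.
rewrite label_nbr//; congr muld.
by case: (label a) (k) => [[] []] [].
Qed.

Theorem corollary3p7 (R : realType) (n : nat) :
  is_branched_cover_of (flat_surface (KS R n)) (flat_surface (KS R 0)).
Proof.
pose color (i : tile_index) : tile_index := (seed, muld i.2 (invd (label i.1))).
apply: (tiled_branched_cover (@triangle_edge_closed R) (c := color)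
  (tiled_surface R n) (tiled_surface R 0)).
- exact: triangle_corners.
- exact: finite_inside_index.
- by [].
- by move=> e [a r] [/= ta _]; rewrite /color across0 across_color.
- move=> [b q] [/= tb /inside0 ->].
  have [a [ta ia _]] := boundary_direction n D0.
  exists (a, muld q (label a)); split=> //.
  by rewrite /color /= -muldA muldV muld1.
- by move=> e [b q] [/= tb /inside0 ->]; rewrite across0 => -[/refl_neq].
move=> [a r] [b q] y [/= _ /inside0 ->] [/= _ /inside0 ->] Dy [e [f [ef ey fy]]].
suff to_one t : surface_chart 0 (seed, t) y = surface_chart 0 (seed, oned) y.
  by rewrite (to_one r) (to_one q).
have [w <-] := refl_generate t ef.
elim: w t => [//|c w IH] t /=; rewrite -IH -across0; apply/esym.
by apply: (@across_glue R 0) => //; case: c.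
Qed.
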